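(* Assume that $F$ satisfies (i)–(iii) of the context, that $A$ is coercive, i.e. there is $\nu>0$ with $\|A^{1/2}u\|^2\ge \nu\|u\|^2$ for all $u\in\mathcal H_1$, and that $\gamma(t)=\alpha/t$ with $\alpha>0$. Then for every sufficiently small $\varepsilon>0$ (i.e. there is $\varepsilon_0>0$ such that for every $\varepsilon\in(0,\varepsilon_0)$) the following holds. Let $t_1\ge t_0$ satisfy $$t_1^2\ge\max\left\{\frac{2\lambda}{\nu}|\alpha-1|,\ \frac{\lambda}{\nu}|3\lambda+1-\alpha|\right\}\quad\text{for both } \lambda=\frac{\alpha}{2}\text{ and }\lambda=\frac{\alpha}{2}+\varepsilon,$$ and let $t_{3,\varepsilon}>0$ be large enough that $$t_{3,\varepsilon}^2\ge\frac{(\frac{\alpha}{2}+\varepsilon)(1+2\varepsilon)}{2\nu\varepsilon}\,|\alpha-2-2\varepsilon|+t_1^2\qquad\text{and}\qquad t_{3,\varepsilon}\ge\frac{2\alpha|\alpha-2|}{\nu}+\sqrt{\frac{\alpha+2}{3\nu}}.$$ Then for every $(u_0,u_1)\in\mathcal H_1\times\mathcal H$, the unique global mild solution $u$ of the Cauchy problem in the context satisfies $$E(t)\le 8\,t_{3,\varepsilon}^{\alpha}\,E(t_0)\,t^{-\alpha},\qquad \forall t\ge t_{3,\varepsilon}.$$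
   Context: $\mathcal H$ is a real Hilbert space with scalar product $\langle\cdot,\cdot\rangle$ and norm $\|\cdot\|$; $A$ is a nonnegative self-adjoint operator on $\mathcal H$ with dense domain $D(A)$; $\mathcal H_1=D(A^{1/2})$ with norm $\|v\|_{\mathcal H_1}=(\|v\|^2+\|A^{1/2}v\|^2)^{1/2}$. Assumptions on $F$: (i) $F:\mathcal H_1\to\mathbb R$ is nonnegative and differentiable with $F(0)=0$, and its gradient is a map $\nabla F:\mathcal H_1\to\mathcal H$ (so $F'(u)h=\langle\nabla F(u),h\rangle$ for $u,h\in\mathcal H_1$). (ii) $\|\nabla F(v)-\nabla F(w)\|\le L_0(\|v\|_{\mathcal H_1},\|w\|_{\mathcal H_1})\|v-w\|_{\mathcal H_1}$ for all $v,w\in\mathcal H_1$, where $L_0$ is a positive function on $\mathbb R^+\times\mathbb R^+$ bounded on bounded sets. (iii) There is a constant $s>2$ with $sF(u)\le\langle\nabla F(u),u\rangle$ for all $u\in\mathcal H_1$. Cauchy problem: $u''(t)+Au(t)+\gamma(t)u'(t)+\nabla F(u(t))=0$ for $t\ge t_0$, $u(t_0)=u_0$, $u'(t_0)=u_1$, where $t_0>0$ and $\gamma(t)=\alpha/t$. A mild solution is $u\in C([t_0,\infty);\mathcal H_1)\cap C^1([t_0,\infty);\mathcal H)$ with $$u(t)=S'(t-t_0)u_0+S(t-t_0)u_1-\int_{t_0}^tS(t-\tau)[\gamma(\tau)u'(\tau)+\nabla F(u(\tau))]\,d\tau,$$ where $S(\cdot)$ is the solution operator of $u''+Au=0$ with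 $S(0)=0$, $S'(0)=I$. For each $(u_0,u_1)\in\mathcal H_1\times\mathcal H$ a unique global mild solution exists. Energy: $E(t)=\frac12\|u'(t)\|^2+\frac12\|A^{1/2}u(t)\|^2+F(u(t))$. *)

(* Defs.v *)
From Stdlib Require Import Reals.
From Coquelicot Require Import Coquelicot.

Set Implicit Arguments.

Open Scope R_scope.

(* A real Hilbert space: completeness comes from [CompleteNormedModule], and
   [inner_norm] makes the inner product positive definite and the source of
   the norm. *)
Record HilbertSpace := {
  hilbert_space :> CompleteNormedModule R_AbsRing;
  inner : hilbert_space -> hilbert_space -> R;
  inner_sym : forall x y, inner x y = inner y x;
  inner_plus : forall x y z, inner (plus x y) z = inner x z + inner y z;
  inner_scal : forall (a : R) x y, inner (scal a x) y = a * inner x y;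
  inner_norm : forall x, inner x x = norm x ^ 2
}.

(* A possibly unbounded linear operator.  The underlying function is total,
   but its values outside [dom] are irrelevant. *)
Record operator (H : HilbertSpace) := {
  dom : H -> Prop;
  op :> H -> H;
  dom_zero : dom zero;
  dom_plus : forall x y, dom x -> dom y -> dom (plus x y);
  dom_scal : forall (a : R) x, dom x -> dom (scal a x);
  op_plus : forall x y, dom x -> dom y -> op (plus x y) = plus (op x) (op y);
  op_scal : forall (a : R) x, dom x -> op (scal a x) = scal a (op x)
}.

Section Operators.

Variable H : HilbertSpace.
Implicit Types A B : operator H.

Definition densely_defined A : Prop :=
  forall (x : H) (eps : R), 0 < eps ->
    exists y : H, dom A y /\ norm (minus x y) < eps.

(* The right-hand side says that [(y, z)] is in the graph of the adjoint. *)
Definition self_adjoint A : Prop :=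
  densely_defined A /\
  forall y z : H,
    (dom A y /\ A y = z) <->
    (forall x : H, dom A x -> inner H (A x) y = inner H x z).

Definition nonnegative_operator A : Prop :=
  forall x : H, dom A x -> 0 <= inner H (A x) x.

(* B = A^{1/2}: the nonnegative self-adjoint operator such that A = B o B,
   domains included. *)
Definition is_square_root A B : Prop :=
  self_adjoint B /\ nonnegative_operator B /\
  (forall x : H, dom A x <-> (dom B x /\ dom B (B x))) /\
  (forall x : H, dom A x -> A x = B (B x)).

(* In what follows B stands for A^{1/2}, so that H_1 is [dom B]. *)
Definition norm1 B (v : H) : R := sqrt (norm v ^ 2 + norm (B v) ^ 2).

Definition coercive B (nu : R) : Prop :=
  forall v : H, dom B v -> nu * norm v ^ 2 <= norm (B v) ^ 2.

(* F and its gradient G are maps on H_1: only their values on [dom B] are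
   constrained.  Differentiability is Frechet differentiability for the norm
   of H_1, the derivative at u being <G u, .>. *)
Definition is_potential B (F : H -> R) (G : H -> H) : Prop :=
  (forall v : H, dom B v -> 0 <= F v) /\
  F zero = 0 /\
  (forall v : H, dom B v -> forall eps : R, 0 < eps ->
     exists delta : R, 0 < delta /\
       forall h : H, dom B h -> norm1 B h < delta ->
         Rabs (F (plus v h) - F v - inner H (G v) h) <= eps * norm1 B h).

Definition positive_locally_bounded (L : R -> R -> R) : Prop :=
  (forall a b : R, 0 <= a -> 0 <= b -> 0 < L a b) /\
  (forall r : R, exists M : R, forall a b : R,
     0 <= a <= r -> 0 <= b <= r -> L a b <= M).

Definition locally_lipschitz B (G : H -> H) (L : R -> R -> R) : Prop :=
  forall v w : H, dom B v -> dom B w ->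
    norm (minus (G v) (G w)) <= L (norm1 B v) (norm1 B w) * norm1 B (minus v w).

Definition superquadratic B (F : H -> R) (G : H -> H) (s : R) : Prop :=
  forall v : H, dom B v -> s * F v <= inner H (G v) v.

(* [S t v] is the value at time t of the solution of u'' + A u = 0, u(0) = 0,
   u'(0) = v, and [dS t v] is its time derivative; formally
   S(t) = A^{-1/2} sin(t A^{1/2}) and dS(t) = cos(t A^{1/2}).
   The solution is classical (C^2) for v in H_1; as H_1 is dense and [is_linear]
   includes boundedness, these conditions determine S. *)
Definition is_solution_operator A B (S dS : R -> H -> H) : Prop :=
  (forall t : R, is_linear (S t)) /\
  (forall v : H, S 0 v = zero) /\
  (forall v : H, dS 0 v = v) /\
  (forall (v : H) (t : R), is_derive (fun r : R => S r v) t (dS t v)) /\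
  (forall (v : H) (t : R), continuous (fun r : R => dS r v) t) /\
  (forall v : H, dom B v -> forall t : R,
     dom A (S t v) /\
     is_derive (fun r : R => dS r v) t (opp (A (S t v))) /\
     continuous (fun r : R => A (S r v)) t).

(* Derivative relative to D, hence one-sided at an endpoint of an interval D;
   [is_derive] is the case where D is everything. *)
Definition is_derive_on (D : R -> Prop) (f : R -> H) (t : R) (l : H) : Prop :=
  filterdiff f (within D (locally t)) (fun h : R => scal h l).

Definition continuous1_on B (D : R -> Prop) (u : R -> H) : Prop :=
  (forall t : R, D t -> dom B (u t)) /\
  (forall t : R, D t ->
     filterlim (fun r : R => norm1 B (minus (u r) (u t)))
       (within D (locally t)) (locally 0)).

(* Mild solution of u'' + A u + gamma u' + G u = 0 on [t0, +oo) with data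
   (u0, u1) at t0; [du] is the derivative of u. *)
Definition is_mild_solution B (S dS : R -> H -> H) (gamma : R -> R)
    (G : H -> H) (t0 : R) (u0 u1 : H) (u du : R -> H) : Prop :=
  let D := fun t : R => t0 <= t in
  continuous1_on B D u /\
  (forall t : R, D t -> is_derive_on D u t (du t)) /\
  continuous_on D du /\
  (forall t : R, D t ->
     exists I : H,
       is_RInt
         (fun tau : R =>
            S (t - tau) (plus (scal (gamma tau) (du tau)) (G (u tau)))) t0 t I /\
       u t = minus (plus (dS (t - t0) u0) (S (t - t0) u1)) I).

Definition energy B (F : H -> R) (u du : R -> H) (t : R) : R :=
  / 2 * norm (du t) ^ 2 + / 2 * norm (B (u t)) ^ 2 + F (u t).

End Operators.

(* Main.v *)
Require Import Defs.
From Stdlib Require Import Reals Lra.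
From Coquelicot Require Import Coquelicot.

Open Scope R_scope.

(** With [l = alpha / 2] the functional
    [t^alpha (E + (l/t) <u', u> + l/(2t^2) |u|^2)] is comparable to [t^alpha E]
    for large [t], and its derivative is at most
    [l (l - 1) t^(alpha - 3) |u|^2], because [s > 2] makes the nonlinear
    terms nonpositive. By coercivity this is absorbed by the weight
    [exp (K / (2t^2))]. The first condition on [t3] makes [nu t3^2] as large as
    needed when [eps] is small.

    For a mild solution the identities for [E'] and [<u', u>'] are obtained
    without resolvents: pairing with elements of [D(A)] and integrating in
    time shows that [P(t) = int_{t0}^t u] lies in [D(A)] with
    [A P = u1 - u' - int f]. The increments [P(t + h) - P(t)] are therefore
    regular enough to be differentiated classically; the identities divided by
    [h^2] pass to the limit [h -> 0+]. *)

(** * Geometry and calculus in a Hilbert space *)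

(** The obstacle is regularity: for data in [H_1 x H] neither [u''] nor [A u] need lie in H, so the
    energy cannot be differentiated term by term. The value l = alpha/2 is dictated by the terms of
    order 1/t. Friction destroys kinetic energy only, at rate (alpha/t)|u'|^2, and the cross term
    (l/t)<u', u> spreads this loss over |u'|^2 and |A^{1/2}u|^2. Against the growth factor t^alpha
    both balances vanish exactly when l = alpha/2, while the coefficient l/(2t^2) of |u|^2 is the
    one that cancels <u', u> at order t^(-2). The remainder has relative order t^(-3), which is
    integrable at infinity: it costs a bounded factor and no power of t, so the exponent is exactly
    alpha. The constant 8 leaves some room: comparing the functional with the energy costs 29/15 at
    [t3] and 5/2 at t, and the exponential weight at most 4/3, with product 58/9. *)

Section InnerProduct.

Variable H : HilbertSpace.
Implicit Types x y z : H.

Lemma inner_plus_r x y z : inner H x (plus y z) = inner H x y + inner H x z.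
Proof. now rewrite inner_sym, inner_plus, (inner_sym _ y), (inner_sym _ z). Qed.

Lemma inner_scal_r (a : R) x y : inner H x (scal a y) = a * inner H x y.
Proof. now rewrite inner_sym, inner_scal, inner_sym. Qed.

Lemma inner_opp x y : inner H (opp x) y = - inner H x y.
Proof.
  assert (E : opp x = scal (opp one) x) by (symmetry; apply (scal_opp_one x)).
  rewrite E, inner_scal. unfold opp, one. simpl. ring.
Qed.

Lemma inner_opp_r x y : inner H x (opp y) = - inner H x y.
Proof. now rewrite inner_sym, inner_opp, inner_sym. Qed.

Lemma inner_minus x y z : inner H (minus x y) z = inner H x z - inner H y z.
Proof. unfold minus. now rewrite inner_plus, inner_opp. Qed.

Lemma inner_minus_r x y z : inner H x (minus y z) = inner H x y - inner H x z.
Proof. unfold minus. now rewrite inner_plus_r, inner_opp_r. Qed.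

Lemma inner_zero x : inner H zero x = 0.
Proof.
  transitivity (inner H (scal 0 x) x).
  - f_equal. symmetry. apply (scal_zero_l x).
  - rewrite inner_scal. ring.
Qed.

Lemma inner_zero_r x : inner H x zero = 0.
Proof. now rewrite inner_sym, inner_zero. Qed.

End InnerProduct.

Ltac expand_inner :=
  repeat first [ rewrite inner_minus | rewrite inner_minus_r
               | rewrite inner_plus | rewrite inner_plus_r
               | rewrite inner_scal | rewrite inner_scal_r
               | rewrite inner_opp | rewrite inner_opp_r
               | rewrite inner_zero | rewrite inner_zero_r ].

Section HilbertGeometry.

Variable H : HilbertSpace.
Implicit Types x y z : H.

Lemma inner_self_nonneg x : 0 <= inner H x x.
Proof. rewrite inner_norm. apply pow2_ge_0. Qed.

Lemma norm_inner x : norm x = sqrt (inner H x x).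
Proof. rewrite inner_norm. symmetry. apply sqrt_pow2, norm_ge_0. Qed.

Lemma Cauchy_Schwarz x y : Rabs (inner H x y) <= norm x * norm y.
Proof.
  pose proof (norm_ge_0 x) as Hx. pose proof (norm_ge_0 y) as Hy.
  (* The squared norm of |y|^2 x - <x,y> y equals |y|^2 (|x|^2 |y|^2 - <x,y>^2); scaling by |y|^2
     avoids a division. *)
  pose proof (inner_self_nonneg
    (minus (scal (norm y ^ 2) x) (scal (inner H x y) y))) as Hq.
  revert Hq. expand_inner. rewrite !inner_norm, (inner_sym _ y x). intro Hq.
  destruct (Req_dec (norm y) 0) as [Hy0|Hy0].
  - pose proof (norm_eq_zero (V := H) y Hy0) as ->. rewrite inner_zero_r, Rabs_R0.
    now apply Rmult_le_pos; [|apply norm_ge_0].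
  - apply Rsqr_incr_0_var; [|now apply Rmult_le_pos].
    rewrite <- Rsqr_abs. unfold Rsqr.
    assert (0 < norm y) by lra.
    assert (0 < norm y ^ 2) by (apply pow_lt; lra).
    apply Rmult_le_reg_l with (norm y ^ 2); [assumption|]. nra.
Qed.

Lemma inner_le_norm x y : inner H x y <= norm x * norm y.
Proof. eapply Rle_trans; [apply Rle_abs|apply Cauchy_Schwarz]. Qed.

(** Serves below to prove vector identities: pairing with an arbitrary [w] turns them into scalar
    ones that [expand_inner] and [ring] settle. *)
Lemma inner_ext x y : (forall z, inner H x z = inner H y z) -> x = y.
Proof.
  intros Hz. apply plus_reg_r with (opp y).
  transitivity (zero : H); [|symmetry; apply (plus_opp_r y)].
  apply (norm_eq_zero (V := H)). change (norm (minus x y) = 0).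
  rewrite norm_inner. expand_inner. rewrite !Hz.
  replace (_ - _) with 0 by ring. apply sqrt_0.
Qed.

Lemma norm_plus_le x y : norm (plus x y) <= norm x + norm y.
Proof. apply (norm_triangle x y). Qed.

Lemma norm_minus_sym x y : norm (minus x y) = norm (minus y x).
Proof. rewrite !norm_inner. f_equal. expand_inner. ring. Qed.

Lemma norm_le_plus_minus x y : norm y <= norm x + norm (minus x y).
Proof.
  rewrite norm_minus_sym.
  replace y with (plus x (minus y x)) at 1.
  - apply norm_plus_le.
  - apply inner_ext. intros w. expand_inner. ring.
Qed.

Definition dense (D : H -> Prop) : Prop :=
  forall x (eps : R), 0 < eps -> exists y, D y /\ norm (minus x y) < eps.

Lemma dense_full : dense (fun _ => True).
Proof.
  intros x eps Heps. exists x. split; [trivial|].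
  rewrite norm_inner. expand_inner.
  replace (_ - _) with 0 by ring. now rewrite sqrt_0.
Qed.

(** Testing against some [y] of [D] close to [x] itself almost recovers |x|^2. The lemma yields norm
    bounds for vectors involving [B], whose pairings are accessible only on [dom B]. *)
Lemma dense_norm_le (D : H -> Prop) x (c : R) : dense D -> 0 <= c ->
  (forall y, D y -> inner H x y <= c * norm y) -> norm x <= c.
Proof.
  intros HD Hc Hb. apply Rnot_lt_le. intro Hlt.
  pose proof (norm_ge_0 x) as Hx.
  set (e := (norm x - c) / 4).
  (* With d this radius, the two bounds on <x,y> give 4e|x| <= (|x| + c) d, whereas d is chosen so
     that (|x| + c) d <= e|x|. *)
  destruct (HD x (e * norm x / (norm x + c + e))) as [y [Dy Hy]].
  { unfold e. apply Rdiv_lt_0_compat; nra. }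
  specialize (Hb y Dy).
  set (d := e * norm x / (norm x + c + e)) in *.
  assert (Hd : d * (norm x + c + e) = e * norm x).
  { unfold d. field. unfold e. lra. }
  assert (He : 0 < e) by (unfold e; lra).
  pose proof (inner_le_norm x (minus x y)) as H1.
  rewrite inner_minus_r, inner_norm in H1.
  pose proof (norm_le_plus_minus x y) as H2.
  assert (0 <= norm (minus x y)) by apply norm_ge_0.
  assert (norm x = c + 4 * e) by (unfold e; lra).
  nra.
Qed.

Lemma dense_locally (D : H -> Prop) x (P : H -> Prop) :
  dense D -> locally x P -> exists y, D y /\ P y.
Proof.
  intros HD HP.
  destruct (locally_norm_le_locally x P HP) as [eps Heps].
  destruct (HD x eps (cond_pos eps)) as [y [Dy Hy]].
  exists y. split; [assumption|]. apply Heps.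
  unfold ball_norm. now rewrite norm_minus_sym in Hy.
Qed.

Lemma dense_continuous_ext (D : H -> Prop) (f g : H -> R) : dense D ->
  (forall x, continuous f x) -> (forall x, continuous g x) ->
  (forall x, D x -> f x = g x) -> forall x, f x = g x.
Proof.
  intros HD Cf Cg Heq x. apply Rminus_diag_uniq, Rabs_eq_0.
  apply Rle_antisym; [|apply Rabs_pos]. apply Rnot_lt_le. intro Hlt.
  set (e := Rabs (f x - g x)) in *.
  assert (He : 0 < e / 2) by lra.
  pose proof (proj1 (filterlim_locally f (f x)) (Cf x) (mkposreal _ He)) as Hf.
  pose proof (proj1 (filterlim_locally g (g x)) (Cg x) (mkposreal _ He)) as Hg.
  destruct (dense_locally D x _ HD (filter_and _ _ Hf Hg)) as [y [Dy [Hfy Hgy]]].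
  rewrite <- (Heq y Dy) in Hgy.
  change (Rabs (f y - f x) < e / 2) in Hfy.
  change (Rabs (f y - g x) < e / 2) in Hgy.
  assert (e <= Rabs (f y - f x) + Rabs (f y - g x)).
  { unfold e. replace (f x - g x) with (- (f y - f x) + (f y - g x)) by ring.
    eapply Rle_trans; [apply Rabs_triang|]. rewrite Rabs_Ropp. lra. }
  lra.
Qed.

Lemma dense_inner_ext (D : H -> Prop) x y : dense D ->
  (forall z, D z -> inner H x z = inner H y z) -> x = y.
Proof.
  intros HD Hz. apply inner_ext. intros w. apply Rminus_diag_uniq.
  rewrite <- inner_minus.
  assert (H0 : norm (minus x y) <= 0).
  { apply (dense_norm_le D); [assumption|lra|].
    intros z Dz. rewrite inner_minus, (Hz z Dz). lra. }
  pose proof (norm_ge_0 w). pose proof (norm_ge_0 (minus x y)).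
  pose proof (Cauchy_Schwarz (minus x y) w) as Hc.
  apply Rabs_le_between in Hc. nra.
Qed.

Lemma filterlim_norm_minus {T : Type} {F : (T -> Prop) -> Prop} {FF : Filter F}
  (f : T -> H) x :
  filterlim f F (locally x) <->
  (forall eps : R, 0 < eps -> F (fun t => norm (minus (f t) x) < eps)).
Proof.
  split.
  - intros Hf eps Heps.
    exact (proj1 (filterlim_locally_ball_norm f x) Hf (mkposreal eps Heps)).
  - intros Hf. apply (filterlim_locally_ball_norm f x).
    intros eps. exact (Hf eps (cond_pos eps)).
Qed.

Lemma filterlim_inner {T : Type} {F : (T -> Prop) -> Prop} {FF : Filter F}
  (f g : T -> H) x y :
  filterlim f F (locally x) -> filterlim g F (locally y) ->
  filterlim (fun t => inner H (f t) (g t)) F (locally (inner H x y)).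
Proof.
  intros Hf Hg.
  pose proof (proj1 (filterlim_norm_minus f x) Hf) as Hf'.
  pose proof (proj1 (filterlim_norm_minus g y) Hg) as Hg'.
  apply filterlim_locally. intros [eps Heps].
  pose proof (norm_ge_0 x) as Hx. pose proof (norm_ge_0 y) as Hy.
  set (d := Rmin 1 (eps / (norm x + norm y + 2))).
  assert (Hd : 0 < d).
  { apply Rmin_glb_lt; [lra|]. apply Rdiv_lt_0_compat; lra. }
  assert (Hd1 : d <= 1) by apply Rmin_l.
  assert (Hde : d * (norm x + norm y + 2) <= eps).
  { apply Rle_trans with (eps / (norm x + norm y + 2) * (norm x + norm y + 2)).
    - apply Rmult_le_compat_r; [lra|apply Rmin_r].
    - right. field. lra. }
  generalize (filter_and _ _ (Hf' d Hd) (Hg' d Hd)). apply filter_imp.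
  intros t [Hft Hgt]. change (Rabs (inner H (f t) (g t) - inner H x y) < eps).
  replace (inner H (f t) (g t) - inner H x y) with
    (inner H (minus (f t) x) (minus (g t) y) + inner H (minus (f t) x) y
     + inner H x (minus (g t) y)) by (expand_inner; ring).
  pose proof (Cauchy_Schwarz (minus (f t) x) (minus (g t) y)).
  pose proof (Cauchy_Schwarz (minus (f t) x) y).
  pose proof (Cauchy_Schwarz x (minus (g t) y)).
  assert (0 <= norm (minus (f t) x)) by apply norm_ge_0.
  assert (0 <= norm (minus (g t) y)) by apply norm_ge_0.
  eapply Rle_lt_trans; [apply Rabs_triang|].
  eapply Rle_lt_trans; [apply Rplus_le_compat_r, Rabs_triang|].
  nra.
Qed.

Lemma continuous_inner {T : UniformSpace} (f g : T -> H) (t : T) :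
  continuous f t -> continuous g t ->
  continuous (fun r => inner H (f r) (g r)) t.
Proof. apply filterlim_inner. Qed.

Lemma is_derive_norm_minus (f : R -> H) (t : R) (l : H) :
  is_derive f t l <->
  (forall eps : R, 0 < eps -> locally t (fun r =>
     norm (minus (minus (f r) (f t)) (scal (r - t) l)) <= eps * Rabs (r - t))).
Proof.
  split.
  - intros [_ Hf] eps Heps.
    exact (Hf t (fun P HP => HP) (mkposreal eps Heps)).
  - intros Hf. split; [apply is_linear_scal_l|].
    intros x Hx eps. rewrite <- (is_filter_lim_locally_unique _ _ Hx).
    exact (Hf eps (cond_pos eps)).
Qed.

Lemma is_derive_continuous (f : R -> H) (t : R) (l : H) :
  is_derive f t l -> continuous f t.
Proof.
  intros Hf.
  exact (ex_derive_continuous (K := R_AbsRing) (V := H) f t (ex_intro _ l Hf)).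
Qed.

Lemma is_derive_inner (f g : R -> H) (t : R) (df dg : H) :
  is_derive f t df -> is_derive g t dg ->
  is_derive (fun r => inner H (f r) (g r)) t (inner H df (g t) + inner H (f t) dg).
Proof.
  intros Hf Hg.
  assert (Cg : continuous g t).
  { now apply is_derive_continuous with dg. }
  pose proof (proj1 (filterlim_norm_minus (F := locally t) g (g t)) Cg) as Cg'.
  pose proof (proj1 (is_derive_norm_minus f t df) Hf) as Hf'.
  pose proof (proj1 (is_derive_norm_minus g t dg) Hg) as Hg'.
  split; [apply is_linear_scal_l|].
  intros r0 Hr0 [eps Heps]. rewrite <- (is_filter_lim_locally_unique _ _ Hr0).
  simpl.
  pose proof (norm_ge_0 df). pose proof (norm_ge_0 (f t)). pose proof (norm_ge_0 (g t)).
  set (N := norm df + norm (f t) + norm (g t) + 1).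
  set (d := Rmin 1 (eps / N)).
  assert (Hd : 0 < d).
  { apply Rmin_glb_lt; [lra|]. apply Rdiv_lt_0_compat; unfold N; lra. }
  assert (Hd1 : d <= 1) by apply Rmin_l.
  assert (Hde : d * N <= eps).
  { apply Rle_trans with (eps / N * N).
    - apply Rmult_le_compat_r; [unfold N; lra|apply Rmin_r].
    - right. field. unfold N. lra. }
  generalize (filter_and _ _ (filter_and _ _ (Hf' d Hd) (Hg' d Hd)) (Cg' d Hd)).
  apply filter_imp. intros r [[Hfr Hgr] Cgr].
  change (Rabs (inner H (f r) (g r) - inner H (f t) (g t)
    - (r - t) * (inner H df (g t) + inner H (f t) dg)) <= eps * Rabs (r - t)).
  set (p := minus (minus (f r) (f t)) (scal (r - t) df)) in *.
  set (q := minus (minus (g r) (g t)) (scal (r - t) dg)) in *.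
  replace (inner H (f r) (g r) - inner H (f t) (g t)
    - (r - t) * (inner H df (g t) + inner H (f t) dg)) with
    (inner H p (minus (g r) (g t)) + inner H p (g t)
     + (r - t) * inner H df (minus (g r) (g t)) + inner H (f t) q)
    by (unfold p, q; expand_inner; ring).
  pose proof (Cauchy_Schwarz p (minus (g r) (g t))).
  pose proof (Cauchy_Schwarz p (g t)).
  pose proof (Cauchy_Schwarz df (minus (g r) (g t))).
  pose proof (Cauchy_Schwarz (f t) q).
  pose proof (Rabs_pos (r - t)) as Ha.
  set (a := Rabs (r - t)) in *.
  assert (0 <= norm p) by apply norm_ge_0.
  assert (0 <= norm q) by apply norm_ge_0.
  assert (0 <= norm (minus (g r) (g t))) by apply norm_ge_0.
  set (m := norm (minus (g r) (g t))) in *.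
  assert (norm p * m <= d * a * 1) by nra.
  assert (norm p * norm (g t) <= d * a * norm (g t)) by nra.
  assert (norm (f t) * norm q <= norm (f t) * (d * a)) by nra.
  assert (a * (norm df * m) <= a * (norm df * d)) by (apply Rmult_le_compat_l; nra).
  assert (Rabs ((r - t) * inner H df (minus (g r) (g t))) <= a * (norm df * m)).
  { rewrite Rabs_mult. fold a. apply Rmult_le_compat_l; assumption. }
  apply Rle_trans with (a * (d * N)).
  - eapply Rle_trans; [apply Rabs_triang|].
    eapply Rle_trans; [apply Rplus_le_compat_r, Rabs_triang|].
    eapply Rle_trans; [apply Rplus_le_compat_r, Rplus_le_compat_r, Rabs_triang|].
    unfold N. nra.
  - rewrite Rmult_comm. apply Rmult_le_compat_r; assumption.
Qed.

Lemma is_derive_inner_l (f : R -> H) (t : R) (df w : H) :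
  is_derive f t df -> is_derive (fun r => inner H (f r) w) t (inner H df w).
Proof.
  intros Hf. replace (inner H df w) with (inner H df w + inner H (f t) zero)
    by (rewrite inner_zero_r; ring).
  apply (is_derive_inner f (fun _ => w)); [assumption|apply @is_derive_const].
Qed.

Lemma Riemann_sum_inner (f : R -> H) (w : H) (ptd : SF_seq.SF_seq) :
  inner H (Riemann_sum f ptd) w = Riemann_sum (fun r => inner H (f r) w) ptd.
Proof.
  unfold Riemann_sum.
  match goal with |- context [seq.pairmap _ ?p _] => generalize p end.
  induction (SF_seq.SF_t ptd) as [|a l IH]; intros p; simpl.
  - apply inner_zero.
  - rewrite inner_plus, inner_scal, IH. reflexivity.
Qed.

(** Riemann sums are finite linear combinations, so pairing commutes with them, and continuity of
    the inner product passes to the limit. *)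
Lemma is_RInt_inner (f : R -> H) (a b : R) (l w : H) :
  is_RInt f a b l -> is_RInt (fun r => inner H (f r) w) a b (inner H l w).
Proof.
  intros Hf.
  apply filterlim_ext with (fun ptd => inner H (scal (sign (b - a)) (Riemann_sum f ptd)) w).
  - intros ptd. rewrite inner_scal. now rewrite Riemann_sum_inner.
  - apply (filterlim_inner _ (fun _ => w)); [assumption|apply filterlim_const].
Qed.

Lemma is_derive_inner_r (f : R -> H) (t : R) (df w : H) :
  is_derive f t df -> is_derive (fun r => inner H w (f r)) t (inner H w df).
Proof.
  intros Hf. rewrite inner_sym.
  apply (is_derive_ext (fun r => inner H (f r) w)); [intros; apply inner_sym|].
  now apply is_derive_inner_l.
Qed.

Lemma is_derive_shift (f : R -> H) (c t : R) (df : H) :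
  is_derive f (t - c) df -> is_derive (fun r => f (r - c)) t df.
Proof.
  intros Hf. replace df with (scal 1 df) by apply (scal_one df).
  apply (is_derive_comp f (fun r => r - c)); [assumption|].
  auto_derive; [trivial|ring].
Qed.

(** Leibniz's rule for a parameter that is also the upper endpoint; the last term is the integrand
    at [tau = t]. Pairing [f] with [k] makes the integrand real-valued, so the scalar theorem on
    parametric integrals applies. *)
Lemma is_derive_convolution (f k dk : R -> H) (a t : R) :
  (forall r, continuous f r) -> (forall r, is_derive k r (dk r)) ->
  (forall r, continuous dk r) ->
  is_derive (fun r => RInt (fun tau => inner H (f tau) (k (r - tau))) a r) t
    (RInt (fun tau => inner H (f tau) (dk (t - tau))) a t + inner H (f t) (k 0)).
Proof.
  intros Cf Dk Cdk.
  assert (Ck : forall r, continuous k r).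
  { intros r. now apply is_derive_continuous with (dk r). }
  assert (C2 : forall (g : R -> H) p tau, (forall r, continuous g r) ->
    continuity_2d_pt (fun u v => inner H (f v) (g (u - v))) p tau).
  { intros g p tau Cg. apply continuity_2d_pt_filterlim.
    apply (continuous_inner (fun q : R * R => f (snd q)) (fun q => g (fst q - snd q)) (p, tau)).
    - apply continuous_comp; [apply continuous_snd|apply Cf].
    - apply (continuous_comp (fun q : R * R => fst q - snd q) g); [|apply Cg].
      apply (continuous_minus (V := R_NormedModule)); [apply continuous_fst|apply continuous_snd]. }
  assert (C1 : forall (g : R -> H) p tau, (forall r, continuous g r) ->
    continuous (fun v => inner H (f v) (g (p - v))) tau).
  { intros g p tau Cg. apply continuous_inner; [apply Cf|].
    apply (continuous_comp (fun v : R => p - v) g); [|apply Cg].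
    apply (continuous_minus (V := R_NormedModule)); [apply continuous_const|apply continuous_id]. }
  assert (D1 : forall p tau,
    is_derive (fun u => inner H (f tau) (k (u - tau))) p (inner H (f tau) (dk (p - tau)))).
  { intros p tau. apply is_derive_inner_r, is_derive_shift, Dk. }
  assert (E1 : forall p tau,
    Derive (fun u => inner H (f tau) (k (u - tau))) p = inner H (f tau) (dk (p - tau))).
  { intros p tau. apply is_derive_unique, D1. }
  assert (C3 : forall p tau, continuity_2d_pt
    (fun u v => Derive (fun q => inner H (f v) (k (q - v))) u) p tau).
  { intros p tau.
    apply (continuity_2d_pt_ext (fun u v => inner H (f v) (dk (u - v)))).
    - intros u v. now rewrite E1.
    - now apply C2. }
  assert (I1 : forall p b c, ex_RInt (fun tau => inner H (f tau) (k (p - tau))) b c).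
  { intros p b c. apply (ex_RInt_continuous (V := R_CompleteNormedModule)).
    intros q _. now apply C1. }
  (* The derivative is put in the shape of the library theorem: the integral of a [Derive], plus the
     integrand at the endpoint times the endpoint's speed 1. *)
  replace (k 0) with (k (t - t)) by (f_equal; ring).
  rewrite <- (RInt_ext _ _ a t (fun tau _ => E1 t tau)).
  rewrite <- (Rmult_1_r (inner H (f t) (k (t - t)))).
  apply (is_derive_RInt_param_bound_comp_aux3
    (fun p tau => inner H (f tau) (k (p - tau))) a (fun r => r) t 1).
  - apply filter_forall. intros. apply I1.
  - exists (mkposreal 1 Rlt_0_1). apply filter_forall. intros. apply I1.
  - apply (is_derive_id (K := R_AbsRing)).
  - exists (mkposreal 1 Rlt_0_1). apply filter_forall. intros p tau _.
    eexists. apply D1.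
  - intros. apply C3.
  - exists (mkposreal 1 Rlt_0_1). intros. apply C3.
  - apply continuity_pt_filterlim. apply (C1 k t t Ck).
Qed.

End HilbertGeometry.

(** * Self-adjoint operators and the solution operator *)

Section SelfAdjoint.

Variable H : HilbertSpace.

Lemma self_adjoint_dense (T : operator H) : self_adjoint T -> dense H (dom T).
Proof. intros [HT _]. exact HT. Qed.

Lemma self_adjoint_sym (T : operator H) (x y : H) : self_adjoint T ->
  dom T x -> dom T y -> inner H (T x) y = inner H x (T y).
Proof.
  intros [_ HT] Dx Dy. exact (proj1 (HT y (T y)) (conj Dy eq_refl) x Dx).
Qed.

(** The regularity half of self-adjointness: a purely weak identity already places [y] in the
    domain. *)
Lemma self_adjoint_dom (T : operator H) (y z : H) : self_adjoint T ->
  (forall x, dom T x -> inner H (T x) y = inner H x z) -> dom T y /\ T y = z.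
Proof. intros [_ HT] Hyz. now apply HT. Qed.

Lemma dom_minus (T : operator H) (x y : H) :
  dom T x -> dom T y -> dom T (minus x y).
Proof.
  intros Dx Dy. replace (minus x y) with (plus x (scal (-1) y)).
  - apply dom_plus; [assumption|now apply dom_scal].
  - apply inner_ext. intros w. expand_inner. ring.
Qed.

Lemma op_minus (T : operator H) (x y : H) :
  dom T x -> dom T y -> T (minus x y) = minus (T x) (T y).
Proof.
  intros Dx Dy. replace (minus x y) with (plus x (scal (-1) y)).
  - rewrite op_plus, op_scal; [|assumption|assumption|now apply dom_scal].
    apply inner_ext. intros w. expand_inner. ring.
  - apply inner_ext. intros w. expand_inner. ring.
Qed.

Variables A B : operator H.
Hypothesis B_sqrt : is_square_root A B.

Lemma sqrt_dom (x : H) : dom A x -> dom B x.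
Proof. intros Dx. destruct B_sqrt as [_ [_ [HD _]]]. now apply HD. Qed.

Lemma sqrt_inner (x y : H) : dom A x -> dom B y ->
  inner H (A x) y = inner H (B x) (B y).
Proof.
  intros Dx Dy. destruct B_sqrt as [sB [_ [HD HA]]].
  rewrite HA by assumption. apply self_adjoint_sym; [assumption| |assumption].
  now apply HD.
Qed.

End SelfAdjoint.

Section SolutionOperator.

Variable H : HilbertSpace.
Variables A B : operator H.
Hypothesis A_self_adjoint : self_adjoint A.
Hypothesis B_sqrt : is_square_root A B.
Variables S dS : R -> H -> H.
Hypothesis S_solution : is_solution_operator A B S dS.

Lemma solution_derive (v : H) (t : R) : is_derive (fun r => S r v) t (dS t v).
Proof. apply S_solution. Qed.

Lemma solution_zero (v : H) : S 0 v = zero.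
Proof. apply S_solution. Qed.

Lemma solution_derive_zero (v : H) : dS 0 v = v.
Proof. apply S_solution. Qed.

Lemma solution_derive2 (v : H) (t : R) : dom B v ->
  is_derive (fun r => dS r v) t (opp (A (S t v))).
Proof. intros Dv. now apply S_solution. Qed.

Lemma solution_dom (v : H) (t : R) : dom B v -> dom A (S t v).
Proof. intros Dv. now apply S_solution. Qed.

Lemma constant_of_derive_zero (f : R -> R) (a b : R) :
  (forall t, is_derive f t 0) -> f a = f b.
Proof.
  intros Hf. destruct (MVT_gen f a b (fun _ => 0)) as [c [_ Hc]].
  - intros x _. apply Hf.
  - intros x _. apply continuity_pt_filterlim, (ex_derive_continuous (V := R_NormedModule)).
    now exists 0.
  - lra.
Qed.

Lemma is_derive_reverse (f : R -> H) (c t : R) (df : H) :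
  is_derive f (c - t) df -> is_derive (fun r => f (c - r)) t (opp df).
Proof.
  intros Hf. replace (opp df) with (scal (-1) df) by apply (scal_opp_one df).
  apply (is_derive_comp f (fun r => c - r)); [assumption|].
  auto_derive; [trivial|ring].
Qed.

(* The bilinear concomitant of r |-> S (t - r) v and r |-> S r w is constant. *)
Lemma solution_sym_dom (t : R) (v w : H) : dom B v -> dom B w ->
  inner H (S t v) w = inner H v (S t w).
Proof.
  intros Dv Dw.
  pose proof (constant_of_derive_zero (fun r =>
    inner H (S (t - r) v) (dS r w) + inner H (dS (t - r) v) (S r w)) 0 t) as Hc.
  simpl in Hc. rewrite Rminus_0_r, Rminus_diag in Hc.
  rewrite !solution_zero, !solution_derive_zero in Hc.
  rewrite inner_zero, inner_zero_r in Hc.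
  rewrite Rplus_0_r, Rplus_0_l in Hc. apply Hc. clear Hc. intros r.
  pose proof (is_derive_reverse (fun r => S r v) t r _ (solution_derive v (t - r))) as D1.
  pose proof (is_derive_reverse (fun r => dS r v) t r _ (solution_derive2 v (t - r) Dv)) as D2.
  pose proof (is_derive_plus _ _ _ _ _
    (is_derive_inner H _ _ r _ _ D1 (solution_derive2 w r Dw))
    (is_derive_inner H _ _ r _ _ D2 (solution_derive w r))) as D3.
  match type of D3 with is_derive _ _ ?l => replace 0 with l; [exact D3|] end.
  unfold plus. simpl. expand_inner.
  rewrite (self_adjoint_sym H A (S (t - r) v) (S r w)); auto using solution_dom.
  ring.
Qed.

(** Each [S t] is bounded, so the identity extends from the dense set [dom B] to H, one variable at
    a time. *)
Lemma solution_sym (t : R) (v w : H) : inner H (S t v) w = inner H v (S t w).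
Proof.
  assert (dB : dense H (dom B)) by apply self_adjoint_dense, B_sqrt.
  assert (cS : forall x, continuous (S t) x).
  { intros x. apply (linear_cont (S t)), S_solution. }
  assert (cI : forall x : H, continuous (fun y : H => y) x) by (intros x; apply continuous_id).
  assert (cC : forall x y : H, continuous (fun _ : H => x) y) by (intros; apply continuous_const).
  revert v. apply (dense_continuous_ext H (dom B)); [assumption| | |].
  - intros x. now apply continuous_inner.
  - intros x. now apply (continuous_inner H (fun v => v) (fun _ => S t w)).
  - intros v Dv. revert w. apply (dense_continuous_ext H (dom B)); [assumption| | |].
    + intros x. now apply (continuous_inner H (fun _ => S t v) (fun w => w)).
    + intros x. now apply continuous_inner.
    + intros w Dw. now apply solution_sym_dom.
Qed.

Lemma is_derive_unique_ext (f g : R -> R) (t a b : R) :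
  is_derive f t a -> is_derive g t b -> (forall r, f r = g r) -> a = b.
Proof.
  intros Hf Hg Hfg. rewrite <- (is_derive_unique _ _ _ Hf).
  rewrite <- (is_derive_unique _ _ _ Hg). now apply Derive_ext.
Qed.

Lemma solution_derive_sym (t : R) (v w : H) :
  inner H (dS t v) w = inner H v (dS t w).
Proof.
  apply (is_derive_unique_ext (fun r => inner H (S r v) w)
    (fun r => inner H v (S r w)) t).
  - apply is_derive_inner_l, solution_derive.
  - apply is_derive_inner_r, solution_derive.
  - intros r. apply solution_sym.
Qed.

(** Differentiating <dS w, v> = <w, dS v> in time gives <A S w, v> = <w, A S v> = <A w, S v> = <S A
    w, v> for [v] in the dense set [dom B]. *)
Lemma solution_commutes (t : R) (w : H) : dom A w -> A (S t w) = S t (A w).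
Proof.
  intros Dw. pose proof (sqrt_dom H A B B_sqrt w Dw) as DBw.
  apply (dense_inner_ext H (dom B)); [apply self_adjoint_dense, B_sqrt|].
  intros v Dv.
  assert (E : inner H (opp (A (S t w))) v = inner H w (opp (A (S t v)))).
  { apply (is_derive_unique_ext (fun r => inner H (dS r w) v)
      (fun r => inner H w (dS r v)) t).
    - now apply is_derive_inner_l, solution_derive2.
    - now apply is_derive_inner_r, solution_derive2.
    - intros r. apply solution_derive_sym. }
  rewrite inner_opp, inner_opp_r in E. apply Ropp_eq_reg in E.
  rewrite E, solution_sym. symmetry.
  apply self_adjoint_sym; auto using solution_dom.
Qed.

End SolutionOperator.

Lemma is_derive_primitive (H : HilbertSpace) (f : R -> H) (a t : R) :
  (forall r, continuous f r) -> is_derive (fun r => RInt f a r) t (f t).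
Proof.
  intros Cf. apply (is_derive_RInt f (fun r => RInt f a r) a t); [|apply Cf].
  apply filter_forall. intros r. apply RInt_correct.
  apply ex_RInt_continuous. intros; apply Cf.
Qed.

Lemma locally_gt (a t : R) : a < t -> locally t (fun r => a < r).
Proof. intros Hat. now apply open_gt. Qed.

(** * Mild solutions *)

Section MildSolution.

Variable H : HilbertSpace.
Variables A B : operator H.
Hypothesis A_self_adjoint : self_adjoint A.
Hypothesis B_sqrt : is_square_root A B.
Variables S dS : R -> H -> H.
Hypothesis S_solution : is_solution_operator A B S dS.
Variables (t0 : R) (u0 u1 : H) (u du f : R -> H).
Hypothesis u_continuous : forall t, continuous u t.
Hypothesis f_continuous : forall t, continuous f t.
Hypothesis u_derive : forall t, t0 < t -> is_derive u t (du t).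
Hypothesis u_mild : forall t, t0 <= t -> exists I : H,
  is_RInt (fun tau => S (t - tau) (f tau)) t0 t I /\
  u t = minus (plus (dS (t - t0) u0) (S (t - t0) u1)) I.

Let convol (k : R -> H) (t : R) : R :=
  RInt (fun tau => inner H (f tau) (k (t - tau))) t0 t.

(** Duhamel's formula paired with [w], with every operator moved onto [w]. Time derivatives then
    fall on the orbit of one fixed vector, and only continuity of [f] is used. *)
Let test (w : H) (t : R) : R :=
  inner H u0 (dS (t - t0) w) + inner H u1 (S (t - t0) w)
  - convol (fun r => S r w) t.

(** The derivative of [dS] is written with [S (A w)] rather than [A (S w)]: the former can be
    differentiated once more even when [A w] lies outside [dom B]. *)
Let dtest (w : H) (t : R) : R :=
  inner H u0 (opp (S (t - t0) (A w))) + inner H u1 (dS (t - t0) w)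
  - convol (fun r => dS r w) t.

Let S_derive := solution_derive H A B S dS S_solution.
Let S_derive2 := solution_derive2 H A B S dS S_solution.

Lemma mild_test (w : H) (t : R) : t0 <= t -> inner H (u t) w = test w t.
Proof.
  intros Ht. destruct (u_mild t Ht) as [I [HI ->]]. unfold test, convol.
  pose proof (solution_sym H A B A_self_adjoint B_sqrt S dS S_solution) as sS.
  pose proof (solution_derive_sym H A B A_self_adjoint B_sqrt S dS S_solution) as sdS.
  expand_inner. rewrite sS, sdS. f_equal. f_equal. symmetry.
  apply is_RInt_unique.
  apply (is_RInt_ext (fun tau => inner H (S (t - tau) (f tau)) w)).
  - intros tau _. apply sS.
  - now apply is_RInt_inner.
Qed.

Lemma is_derive_test (w : H) (t : R) : dom A w -> is_derive (test w) t (dtest w t).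
Proof.
  intros Dw. pose proof (sqrt_dom H A B B_sqrt w Dw) as DBw.
  unfold test, dtest.
  apply (is_derive_minus (V := R_NormedModule)).
  - apply (is_derive_plus (V := R_NormedModule)).
    + apply is_derive_inner_r, (is_derive_shift H (fun r => dS r w)).
      rewrite <- (solution_commutes H A B A_self_adjoint B_sqrt S dS S_solution) by assumption.
      now apply S_derive2.
    + apply is_derive_inner_r, (is_derive_shift H (fun r => S r w)), S_derive.
  - pose proof (is_derive_convolution H f (fun r => S r w) (fun r => dS r w) t0 t
      f_continuous (S_derive w)) as Hc.
    simpl in Hc. rewrite (solution_zero H A B S dS S_solution), inner_zero_r, Rplus_0_r in Hc.
    apply Hc. intros r. apply S_solution.
Qed.

(** The weak form of u'' = - A u - f. The convolution's endpoint term vanished in the first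
    derivative because S(0) = 0; here it produces <f, w> because S'(0) = I. *)
Lemma is_derive_dtest (w : H) (t : R) : dom A w ->
  is_derive (dtest w) t (- test (A w) t - inner H (f t) w).
Proof.
  intros Dw. pose proof (sqrt_dom H A B B_sqrt w Dw) as DBw.
  assert (Cop : forall r, continuous (fun r => opp (S r (A w))) r).
  { intros r. apply (continuous_opp (V := H)), is_derive_continuous with (dS r (A w)), S_derive. }
  replace (- test (A w) t - inner H (f t) w) with
    ((inner H u0 (opp (dS (t - t0) (A w))) + inner H u1 (opp (S (t - t0) (A w))))
     - (convol (fun r => opp (S r (A w))) t + inner H (f t) w)).
  - unfold dtest. apply (is_derive_minus (V := R_NormedModule)).
    + apply (is_derive_plus (V := R_NormedModule)).
      * apply is_derive_inner_r, (is_derive_opp (V := H)).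
        apply (is_derive_shift H (fun r => S r (A w))), S_derive.
      * apply is_derive_inner_r, (is_derive_shift H (fun r => dS r w)).
        rewrite <- (solution_commutes H A B A_self_adjoint B_sqrt S dS S_solution) by assumption.
        now apply S_derive2.
    + rewrite <- (f_equal (inner H (f t)) (solution_derive_zero H A B S dS S_solution w)).
      apply (is_derive_convolution H f (fun r => dS r w)); [assumption| |assumption].
      intros r.
      rewrite <- (solution_commutes H A B A_self_adjoint B_sqrt S dS S_solution) by assumption.
      now apply S_derive2.
  - replace (convol (fun r => opp (S r (A w))) t) with (- convol (fun r => S r (A w)) t).
    + unfold test. expand_inner. ring.
    + unfold convol.
      transitivity (RInt (fun tau => opp (inner H (f tau) (S (t - tau) (A w)))) t0 t);
        [|apply RInt_ext; intros; symmetry; apply inner_opp_r].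
      symmetry. apply (RInt_opp (V := R_CompleteNormedModule)).
      apply (ex_RInt_continuous (V := R_CompleteNormedModule)). intros r _.
      apply continuous_inner; [apply f_continuous|].
      apply (continuous_comp (fun v : R => t - v) (fun r => S r (A w))).
      * apply (continuous_minus (V := R_NormedModule)); [apply continuous_const|apply continuous_id].
      * apply is_derive_continuous with (dS (t - r) (A w)), S_derive.
Qed.

Lemma dtest_start (w : H) : dtest w t0 = inner H u1 w.
Proof.
  unfold dtest, convol. rewrite RInt_point, Rminus_diag.
  rewrite (solution_zero H A B S dS S_solution).
  rewrite (solution_derive_zero H A B S dS S_solution).
  expand_inner. change (@zero R_AbelianMonoid) with 0. unfold zero; simpl. ring.
Qed.

Lemma mild_dtest (w : H) (t : R) : dom A w -> t0 < t -> inner H (du t) w = dtest w t.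
Proof.
  intros Dw Ht.
  transitivity (Derive (fun r => inner H (u r) w) t).
  - symmetry. apply is_derive_unique. now apply is_derive_inner_l, u_derive.
  - apply is_derive_unique. apply (is_derive_ext_loc (test w)).
    + generalize (locally_gt t0 t Ht). apply filter_imp.
      intros r Hr. symmetry. apply mild_test. lra.
    + now apply is_derive_test.
Qed.

(* One integration in time lands in D(A), although u itself is only in H_1. *)
Lemma mild_primitive (t : R) : t0 < t ->
  dom A (RInt u t0 t) /\
  A (RInt u t0 t) = minus u1 (plus (du t) (RInt f t0 t)).
Proof.
  intros Ht. apply self_adjoint_dom; [assumption|]. intros w Dw.
  (* [Q] has zero derivative because [mild_test] at [A w] identifies [test (A w)] with <u, A w>. It
     is built from [dtest], not from <du, w>, so that it is differentiable at the endpoint [t0] as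
     well. *)
  set (Q := fun r => inner H (RInt u t0 r) (A w) + dtest w r + inner H (RInt f t0 r) w).
  assert (HQ : Q t0 = Q t).
  { apply (eq_is_derive (V := R_NormedModule)); [|assumption].
    intros r [Hr _]. unfold Q.
    replace (@zero R_NormedModule) with
      (inner H (u r) (A w) + (- test (A w) r - inner H (f r) w) + inner H (f r) w).
    - apply (is_derive_plus (V := R_NormedModule)).
      + apply (is_derive_plus (V := R_NormedModule)).
        * now apply is_derive_inner_l, is_derive_primitive.
        * now apply is_derive_dtest.
      + now apply is_derive_inner_l, is_derive_primitive.
    - rewrite <- mild_test by assumption. unfold zero; simpl. ring. }
  unfold Q in HQ.
  rewrite dtest_start, <- (mild_dtest w t Dw Ht), !RInt_point in HQ.
  rewrite !inner_zero in HQ.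
  expand_inner. rewrite (inner_sym _ (A w)), !(inner_sym _ w). lra.
Qed.

End MildSolution.

(** * Limits of difference quotients *)

Lemma filterlim_Rminus {T : Type} {F : (T -> Prop) -> Prop} {FF : Filter F}
  (f g : T -> R) (a b : R) :
  filterlim f F (locally a) -> filterlim g F (locally b) ->
  filterlim (fun x => f x - g x) F (locally (a - b)).
Proof.
  intros Hf Hg. apply (filterlim_comp_2 f (fun x => - g x) Rplus Hf (H := locally (- b))).
  - apply (filterlim_comp _ _ _ g Ropp _ _ _ Hg), (filterlim_opp (V := R_NormedModule)).
  - apply (filterlim_plus (V := R_NormedModule)).
Qed.

(** Interchange of limit and derivative. The joint limit over [filter_prod] supplies the local
    uniformity: the mean value theorem for [eh h] bounds the remainder by [eps * Rabs (r - t)] for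
    all small h at once, and then h tends to 0. *)
Lemma derive_of_limit (e : R -> R) (eh dh : R -> R -> R) (t0 t q : R) :
  t0 < t ->
  (forall r, t0 < r -> filterlim (fun h => eh h r) (at_right 0) (locally (e r))) ->
  (forall h r, 0 < h -> t0 < r -> is_derive (eh h) r (dh h r)) ->
  filterlim (fun p => dh (snd p) (fst p)) (filter_prod (locally t) (at_right 0))
    (locally q) ->
  is_derive e t q.
Proof.
  intros Ht He Hd Hq.
  split; [apply is_linear_scal_l|].
  intros x Hx [eps Heps]. rewrite <- (is_filter_lim_locally_unique _ _ Hx). clear x Hx.
  simpl.
  destruct (proj1 (filterlim_locally _ q) Hq (mkposreal eps Heps)) as [Q W HQ HW HQW].
  destruct (filter_and _ _ HQ (locally_gt t0 t Ht)) as [d Hball].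
  exists d. intros r Hr.
  change (Rabs (e r - e t - (r - t) * q) <= eps * Rabs (r - t)).
  assert (Htr : t0 < r) by (now apply Hball).
  assert (L : filterlim (fun h => Rabs (eh h r - eh h t - (r - t) * q)) (at_right 0)
    (locally (Rabs (e r - e t - (r - t) * q)))).
  { apply (filterlim_comp _ _ _ (fun h => eh h r - eh h t - (r - t) * q) Rabs _
      (locally (e r - e t - (r - t) * q))); [|apply continuous_Rabs].
    apply filterlim_Rminus; [|apply filterlim_const].
    apply filterlim_Rminus; now apply He. }
  apply (filterlim_le (F := at_right 0) (fun h => Rabs (eh h r - eh h t - (r - t) * q))
    (fun _ => eps * Rabs (r - t)) (Finite _) (Finite _)); [|exact L|apply filterlim_const].
  assert (Hpos : at_right 0 (fun h => 0 < h)).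
  { exists (mkposreal 1 Rlt_0_1). intros h _ Hh. exact Hh. }
  generalize (filter_and _ _ HW Hpos). apply filter_imp. intros h [Wh Hh].
  assert (Hin : forall s, Rmin t r <= s <= Rmax t r -> Q s /\ t0 < s).
  { intros s Hs. apply Hball. change (Rabs (s - t) < d). change (Rabs (r - t) < d) in Hr.
    eapply Rle_lt_trans; [|exact Hr].
    revert Hs. unfold Rmin, Rmax, Rabs. destruct (Rle_dec t r), (Rcase_abs (s - t)),
      (Rcase_abs (r - t)); lra. }
  destruct (MVT_gen (eh h) t r (dh h)) as [c [Hc Ec]].
  - intros s Hs. apply Hd; [assumption|]. apply Hin. lra.
  - intros s Hs. apply continuity_pt_filterlim, (ex_derive_continuous (V := R_NormedModule)).
    eexists. apply Hd; [assumption|]. now apply Hin.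
  - rewrite Ec. replace (_ - _) with ((dh h c - q) * (r - t)) by ring.
    rewrite Rabs_mult. apply Rmult_le_compat_r; [apply Rabs_pos|].
    left. apply (HQW c h); [|assumption]. now apply Hin.
Qed.

Section DifferenceQuotients.

Variable H : HilbertSpace.

Definition quotient (g : R -> H) (p : R * R) : H :=
  scal (/ snd p) (minus (g (fst p + snd p)) (g (fst p))).

(** Weak differentiability against a dense set, together with norm continuity of [dg], gives norm
    convergence. The mean value point depends on the test vector [y], but the bound eps/2 does not,
    so [dense_norm_le] applies. *)
Lemma quotient_lim (D : H -> Prop) (g dg : R -> H) (t0 t : R) :
  dense H D -> t0 < t ->
  (forall y, D y -> forall r, t0 < r ->
     is_derive (fun r => inner H (g r) y) r (inner H (dg r) y)) ->
  continuous dg t ->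
  filterlim (quotient g) (filter_prod (locally t) (at_right 0)) (locally (dg t)).
Proof.
  intros HD Ht Hg Cg. apply (filterlim_norm_minus H). intros eps Heps.
  assert (He : 0 < eps / 2) by lra.
  pose proof (proj1 (filterlim_norm_minus H (F := locally t) dg (dg t)) Cg _ He) as Hdg.
  destruct (filter_and _ _ Hdg (locally_gt t0 t Ht)) as [d Hball].
  assert (Hd : 0 < d / 2) by (pose proof (cond_pos d); lra).
  (* Half radii for the point and for the step keep the whole segment from r to r + h inside the
     ball of radius [d]. *)
  apply (Filter_prod _ _ _ (fun r => Rabs (r - t) < d / 2) (fun h => 0 < h < d / 2)).
  - exists (mkposreal _ Hd). intros r Hr. exact Hr.
  - exists (mkposreal _ Hd). intros h Hh Hp. split; [assumption|].
    change (Rabs (h - 0) < d / 2) in Hh. rewrite Rminus_0_r in Hh.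
    now apply Rabs_lt_between in Hh.
  - intros r h Hr Hh. unfold quotient. simpl.
    apply Rle_lt_trans with (eps / 2); [|lra].
    apply (dense_norm_le H D); [assumption|lra|]. intros y Dy.
    assert (Hin : forall s, Rmin r (r + h) <= s <= Rmax r (r + h) ->
      norm (minus (dg s) (dg t)) < eps / 2 /\ t0 < s).
    { intros s Hs. rewrite Rmin_left, Rmax_right in Hs by lra.
      apply Hball. change (Rabs (s - t) < d).
      apply Rabs_lt_between in Hr. apply Rabs_lt_between. lra. }
    destruct (MVT_gen (fun s => inner H (g s) y) r (r + h)
      (fun s => inner H (dg s) y)) as [c [Hc Ec]].
    + intros s Hs. apply Hg; [assumption|]. apply Hin. lra.
    + intros s Hs. apply continuity_pt_filterlim, (ex_derive_continuous (V := R_NormedModule)).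
      eexists. apply Hg; [assumption|]. now apply Hin.
    + rewrite inner_minus, inner_scal, inner_minus, Ec.
      replace (/ h * (inner H (dg c) y * (r + h - r)) - inner H (dg t) y)
        with (inner H (minus (dg c) (dg t)) y) by (rewrite inner_minus; field; lra).
      eapply Rle_trans; [apply inner_le_norm|].
      apply Rmult_le_compat_r; [apply norm_ge_0|]. left. now apply Hin.
Qed.

Lemma filterlim_slice {T : Type} (g : R * R -> T) (t : R) (G : (T -> Prop) -> Prop) :
  filterlim g (filter_prod (locally t) (at_right 0)) G ->
  filterlim (fun h => g (t, h)) (at_right 0) G.
Proof.
  apply filterlim_comp. apply filterlim_pair; [apply filterlim_const|apply filterlim_id].
Qed.

(** In the product rule the derivative of [f] is multiplied by [g t], which is zero, so continuity
    of [f] is enough. *)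
Lemma is_derive_inner_vanishing (f g : R -> H) (t : R) (dg : H) :
  continuous f t -> is_derive g t dg -> g t = zero ->
  is_derive (fun r => inner H (f r) (g r)) t (inner H (f t) dg).
Proof.
  intros Cf Hg Hz.
  split; [apply is_linear_scal_l|].
  intros x Hx [eps Heps]. rewrite <- (is_filter_lim_locally_unique _ _ Hx). clear x Hx.
  simpl.
  pose proof (proj1 (filterlim_norm_minus H (F := locally t) f (f t)) Cf) as Hf.
  pose proof (proj1 (is_derive_norm_minus H g t dg) Hg) as Hg'.
  pose proof (norm_ge_0 (f t)). pose proof (norm_ge_0 dg).
  set (N := norm (f t) + norm dg + 2).
  set (d := Rmin 1 (eps / N)).
  assert (Hd : 0 < d).
  { apply Rmin_glb_lt; [lra|]. apply Rdiv_lt_0_compat; unfold N; lra. }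
  assert (Hd1 : d <= 1) by apply Rmin_l.
  assert (Hde : d * N <= eps).
  { apply Rle_trans with (eps / N * N).
    - apply Rmult_le_compat_r; [unfold N; lra|apply Rmin_r].
    - right. field. unfold N. lra. }
  generalize (filter_and _ _ (Hf d Hd) (Hg' d Hd)). apply filter_imp.
  intros r [Hfr Hgr].
  change (Rabs (inner H (f r) (g r) - inner H (f t) (g t)
    - (r - t) * inner H (f t) dg) <= eps * Rabs (r - t)).
  set (q := minus (minus (g r) (g t)) (scal (r - t) dg)) in *.
  replace (inner H (f r) (g r) - inner H (f t) (g t) - (r - t) * inner H (f t) dg)
    with (inner H (f r) q + (r - t) * inner H (minus (f r) (f t)) dg)
    by (unfold q; expand_inner; rewrite Hz; expand_inner; ring).
  pose proof (Cauchy_Schwarz H (f r) q).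
  pose proof (Cauchy_Schwarz H (minus (f r) (f t)) dg).
  pose proof (Rabs_pos (r - t)) as Ha.
  set (a := Rabs (r - t)) in *.
  assert (0 <= norm q) by apply norm_ge_0.
  assert (0 <= norm (minus (f r) (f t))) by apply norm_ge_0.
  assert (Hfn : norm (f r) <= norm (f t) + 1).
  { pose proof (norm_le_plus_minus H (f t) (f r)) as Hm.
    rewrite norm_minus_sym in Hm. lra. }
  assert (0 <= norm (f r)) by apply norm_ge_0.
  assert (norm (f r) * norm q <= (norm (f t) + 1) * (d * a)) by nra.
  assert (Rabs ((r - t) * inner H (minus (f r) (f t)) dg) <= a * (d * norm dg)).
  { rewrite Rabs_mult. fold a. apply Rmult_le_compat_l; nra. }
  apply Rle_trans with (a * (d * N)).
  - eapply Rle_trans; [apply Rabs_triang|]. unfold N. nra.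
  - rewrite Rmult_comm. apply Rmult_le_compat_r; assumption.
Qed.

End DifferenceQuotients.

(** * Energy identities *)

Section Evolution.

Variable H : HilbertSpace.
Variables A B : operator H.
Hypothesis A_self_adjoint : self_adjoint A.
Hypothesis B_sqrt : is_square_root A B.
Variables (t0 : R) (c : H) (u du f : R -> H).
Hypothesis u_dom : forall t, dom B (u t).
Hypothesis u_continuous : forall t, continuous u t.
Hypothesis Bu_continuous : forall t, continuous (fun r => B (u r)) t.
Hypothesis du_continuous : forall t, continuous du t.
Hypothesis f_continuous : forall t, continuous f t.
Hypothesis u_derive : forall t, t0 < t -> is_derive u t (du t).
Hypothesis u_equation : forall t, t0 < t ->
  dom A (RInt u t0 t) /\
  A (RInt u t0 t) = minus c (plus (du t) (RInt f t0 t)).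

Let P (t : R) : H := RInt u t0 t.
Let Phi (t : R) : H := RInt f t0 t.

Let P_derive (t : R) : is_derive P t (u t).
Proof. now apply is_derive_primitive. Qed.

Let Phi_derive (t : R) : is_derive Phi t (f t).
Proof. now apply is_derive_primitive. Qed.

Let increment (g : R -> H) (h r : R) : H := minus (g (r + h)) (g r).

Let increment_derive (g dg : R -> H) (h r : R) :
  is_derive g r (dg r) -> is_derive g (r + h) (dg (r + h)) ->
  is_derive (increment g h) r (increment dg h r).
Proof.
  intros Hr Hrh. apply (is_derive_minus (V := H)); [|exact Hr].
  apply (is_derive_ext (fun s => g (s - - h))).
  - intros s. f_equal. unfold Rminus. now rewrite Ropp_involutive.
  - apply is_derive_shift. unfold Rminus. now rewrite Ropp_involutive.
Qed.

Let increment_dom (h r : R) : 0 < h -> t0 < r -> dom A (increment P h r).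
Proof. intros Hh Hr. apply dom_minus; apply u_equation; lra. Qed.

(** The constant [c] cancels. Since [increment P h] has first and second derivatives [increment u h]
    and [increment du h], it is a classical solution U of U'' + A U = - [increment Phi h]. *)
Let increment_equation (h r : R) : 0 < h -> t0 < r ->
  A (increment P h r) = opp (plus (increment du h r) (increment Phi h r)).
Proof.
  intros Hh Hr. unfold increment, P at 1 2.
  rewrite op_minus by (apply u_equation; lra).
  destruct (u_equation (r + h)) as [_ ->]; [lra|].
  destruct (u_equation r) as [_ ->]; [lra|].
  apply inner_ext. intros w. unfold Phi. expand_inner. ring.
Qed.

Let increment_sqrt (h r : R) : 0 < h -> t0 < r ->
  increment (fun s => B (P s)) h r = B (increment P h r).
Proof.
  intros Hh Hr. unfold increment. symmetry.
  apply op_minus; apply (sqrt_dom H A B B_sqrt), u_equation; lra.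
Qed.

(* Only continuity of [A (increment P h r)] is available, but A is symmetric, so
   the increment of the quadratic form factors as
   <A x', x'> - <A x, x> = <A x' + A x, x' - x>. *)
Let form_derive (h r : R) : 0 < h -> t0 < r ->
  is_derive (fun s => inner H (A (increment P h s)) (increment P h s)) r
    (2 * inner H (A (increment P h r)) (increment u h r)).
Proof.
  intros Hh Hr.
  set (U := increment P h) in *. set (z := opp (plus (increment du h r) (increment Phi h r))).
  assert (DU : is_derive U r (increment u h r)).
  { now apply increment_derive. }
  assert (Ci : forall g : R -> H, (forall s, continuous g s) -> continuous (increment g h) r).
  { intros g Cg. apply (continuous_minus (V := H)); [|apply Cg].
    apply (continuous_comp (fun s => s + h) g); [|apply Cg].
    apply (continuous_plus (V := R_NormedModule)); [apply continuous_id|apply continuous_const]. }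
  apply (is_derive_ext_loc (fun s =>
    inner H (plus (opp (plus (increment du h s) (increment Phi h s))) z) (minus (U s) (U r))
    + inner H (A (U r)) (U r))).
  - generalize (locally_gt t0 r Hr). apply filter_imp. intros s Hs.
    unfold z. rewrite <- !increment_equation by assumption. fold U.
    pose proof (self_adjoint_sym H A (U s) (U r) A_self_adjoint
      (increment_dom h s Hh Hs) (increment_dom h r Hh Hr)) as Hsym.
    rewrite (inner_sym _ (U s)) in Hsym. expand_inner. lra.
  - replace (2 * inner H (A (U r)) (increment u h r)) with
      (inner H (plus (opp (plus (increment du h r) (increment Phi h r))) z)
        (increment u h r) + 0).
    + apply (is_derive_plus (V := R_NormedModule)); [|apply @is_derive_const].
      apply (is_derive_inner_vanishing H
        (fun s => plus (opp (plus (increment du h s) (increment Phi h s))) z)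
        (fun s => minus (U s) (U r))).
      * apply (continuous_plus (V := H)); [|apply continuous_const].
        apply (continuous_opp (V := H)), (continuous_plus (V := H)); apply Ci.
        -- assumption.
        -- intros s. now apply is_derive_continuous with (f s).
      * assert (E : minus (increment u h r) zero = increment u h r).
        { apply inner_ext. intros w. expand_inner. ring. }
        rewrite <- E. apply (is_derive_minus (V := H)); [exact DU|apply @is_derive_const].
      * apply inner_ext. intros w. expand_inner. ring.
    + unfold z, U. rewrite <- increment_equation by assumption. expand_inner. ring.
Qed.

Let form_sqrt (h r : R) : 0 < h -> t0 < r ->
  inner H (increment (fun s => B (P s)) h r) (increment (fun s => B (P s)) h r)
  = inner H (A (increment P h r)) (increment P h r).
Proof.
  intros Hh Hr. rewrite increment_sqrt by assumption. symmetry.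
  apply (sqrt_inner H A B B_sqrt); [now apply increment_dom|].
  now apply (sqrt_dom H A B B_sqrt), increment_dom.
Qed.

Let lim_u (t : R) : t0 < t ->
  filterlim (quotient H u) (filter_prod (locally t) (at_right 0)) (locally (du t)).
Proof.
  intros Ht. apply (quotient_lim H (fun _ => True) u du t0); auto using dense_full.
  intros y _ r Hr. now apply is_derive_inner_l, u_derive.
Qed.

Let lim_P (t : R) : t0 < t ->
  filterlim (quotient H P) (filter_prod (locally t) (at_right 0)) (locally (u t)).
Proof.
  intros Ht. apply (quotient_lim H (fun _ => True) P u t0); auto using dense_full.
  intros y _ r Hr. apply is_derive_inner_l, P_derive.
Qed.

Let lim_Phi (t : R) : t0 < t ->
  filterlim (quotient H Phi) (filter_prod (locally t) (at_right 0)) (locally (f t)).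
Proof.
  intros Ht. apply (quotient_lim H (fun _ => True) Phi f t0); auto using dense_full.
  intros y _ r Hr. apply is_derive_inner_l, Phi_derive.
Qed.

(** [B] is unbounded and is not pulled through the integral defining [P]. For y in [dom B] the
    identity <B P, y> = <P, B y> gives the derivative <u, B y> = <B u, y>, which is the weak
    differentiability that [quotient_lim] asks for. *)
Let lim_BP (t : R) : t0 < t ->
  filterlim (quotient H (fun r => B (P r))) (filter_prod (locally t) (at_right 0))
    (locally (B (u t))).
Proof.
  assert (sB : self_adjoint B) by apply B_sqrt.
  intros Ht. apply (quotient_lim H (dom B) _ (fun r => B (u r)) t0);
    auto using self_adjoint_dense.
  intros y Dy r Hr. rewrite (self_adjoint_sym H B (u r) y) by auto.
  apply (is_derive_ext_loc (fun r => inner H (P r) (B y))).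
  - generalize (locally_gt t0 r Hr). apply filter_imp. intros s Hs. symmetry.
    apply self_adjoint_sym; [assumption| |assumption].
    now apply (sqrt_dom H A B B_sqrt), u_equation.
  - apply is_derive_inner_l, P_derive.
Qed.

Let quotient_increment (g k : R -> H) (h r : R) :
  inner H (quotient H g (r, h)) (quotient H k (r, h))
  = / h * / h * inner H (increment g h r) (increment k h r).
Proof. unfold quotient. simpl. rewrite inner_scal, inner_scal_r. unfold increment. ring. Qed.

(** The energy identity for the classical solution U = [increment P h], divided by h^2: the form
    term contributes <A U, U'> = - <U'', U'> - <[increment Phi h], U'>, whose first part cancels the
    derivative of |U'|^2/2. As h tends to 0 the quotients of [u], [B P] and [Phi] become [du], [B u]
    and [f]. *)
Lemma is_derive_kinetic_potential (t : R) : t0 < t ->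
  is_derive (fun r => / 2 * inner H (du r) (du r) + / 2 * inner H (B (u r)) (B (u r))) t
    (- inner H (f t) (du t)).
Proof.
  intros Ht.
  set (qB := quotient H (fun r => B (P r))).
  apply (derive_of_limit _
    (fun h r => / 2 * inner H (quotient H u (r, h)) (quotient H u (r, h))
      + / 2 * inner H (qB (r, h)) (qB (r, h)))
    (fun h r => - inner H (quotient H Phi (r, h)) (quotient H u (r, h))) t0); [assumption| | |].
  - intros r Hr.
    pose proof (filterlim_slice (quotient H u) r _ (lim_u r Hr)) as L1.
    pose proof (filterlim_slice qB r _ (lim_BP r Hr)) as L2.
    assert (half : forall (g : R -> R) l, filterlim g (at_right 0) (locally l) ->
      filterlim (fun h => / 2 * g h) (at_right 0) (locally (/ 2 * l))).
    { intros g l Hg. apply (filterlim_comp _ _ _ g (fun x => / 2 * x) _ _ _ Hg).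
      apply (continuous_scal_r (K := R_AbsRing) (V := R_NormedModule) (/ 2) (fun x => x)), continuous_id. }
    apply (filterlim_comp_2 _ _ Rplus (half _ _ (filterlim_inner H _ _ _ _ L1 L1))
      (half _ _ (filterlim_inner H _ _ _ _ L2 L2))).
    apply (filterlim_plus (V := R_NormedModule)).
  - intros h r Hh Hr. unfold qB.
    apply (is_derive_ext_loc (fun s =>
      / h * / h * (/ 2 * inner H (increment u h s) (increment u h s)
        + / 2 * inner H (A (increment P h s)) (increment P h s)))).
    + generalize (locally_gt t0 r Hr). apply filter_imp. intros s Hs.
      rewrite !quotient_increment, form_sqrt by assumption.
      match goal with |- ?a = ?b => change (@eq R a b) end. ring.
    + assert (Du : is_derive (increment u h) r (increment du h r)).
      { apply increment_derive; apply u_derive; lra. }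
      rewrite quotient_increment.
      replace (- _) with (/ h * / h * (/ 2 * (inner H (increment du h r) (increment u h r)
          + inner H (increment u h r) (increment du h r))
        + / 2 * (2 * inner H (A (increment P h r)) (increment u h r)))).
      * apply is_derive_scal, (is_derive_plus (V := R_NormedModule)); apply is_derive_scal.
        -- now apply is_derive_inner.
        -- now apply form_derive.
      * rewrite increment_equation by assumption.
        rewrite (inner_sym _ (increment u h r)). expand_inner. field. lra.
  - apply (filterlim_comp _ _ _ (fun p => inner H (quotient H Phi p) (quotient H u p)) Ropp _
      (locally (inner H (f t) (du t)))); [|apply (filterlim_opp (V := R_NormedModule))].
    apply (filterlim_ext (fun p => inner H (quotient H Phi p) (quotient H u p)));
      [intros [r h]; reflexivity|].
    apply (filterlim_inner H); [now apply lim_Phi|now apply lim_u].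
Qed.

(** The same scheme for <U', U>: its derivative is |U'|^2 + <U'', U>, and the equation turns <U'',
    U> into - <A U, U> - <[increment Phi h], U>, where [form_sqrt] rewrites <A U, U> as a square. *)
Lemma is_derive_cross (t : R) : t0 < t ->
  is_derive (fun r => inner H (du r) (u r)) t
    (inner H (du t) (du t) - inner H (B (u t)) (B (u t)) - inner H (f t) (u t)).
Proof.
  intros Ht.
  set (qB := quotient H (fun r => B (P r))).
  apply (derive_of_limit _
    (fun h r => inner H (quotient H u (r, h)) (quotient H P (r, h)))
    (fun h r => inner H (quotient H u (r, h)) (quotient H u (r, h))
      - inner H (qB (r, h)) (qB (r, h))
      - inner H (quotient H Phi (r, h)) (quotient H P (r, h))) t0); [assumption| | |].
  - intros r Hr. apply (filterlim_inner H).
    + exact (filterlim_slice (quotient H u) r _ (lim_u r Hr)).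
    + exact (filterlim_slice (quotient H P) r _ (lim_P r Hr)).
  - intros h r Hh Hr. unfold qB. rewrite !quotient_increment, form_sqrt by assumption.
    apply (is_derive_ext (fun s => / h * / h * inner H (increment u h s) (increment P h s))).
    + intros s. now rewrite quotient_increment.
    + replace (_ - _ - _) with (/ h * / h * (inner H (increment du h r) (increment P h r)
        + inner H (increment u h r) (increment u h r))).
      * apply is_derive_scal, is_derive_inner; apply increment_derive; auto; apply u_derive; lra.
      * rewrite increment_equation by assumption. expand_inner. ring.
  - apply (filterlim_ext (fun p => inner H (quotient H u p) (quotient H u p)
      - inner H (qB p) (qB p) - inner H (quotient H Phi p) (quotient H P p)));
      [intros [r h]; reflexivity|].
    pose proof (lim_u t Ht). pose proof (lim_BP t Ht).
    apply filterlim_Rminus; [apply filterlim_Rminus|]; apply (filterlim_inner H); auto.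
Qed.

End Evolution.

(** * The potential along a trajectory *)

Section Potential.

Variable H : HilbertSpace.
Variable B : operator H.

Lemma norm1_ge_0 (v : H) : 0 <= norm1 B v.
Proof. apply sqrt_pos. Qed.

Lemma norm_le_norm1 (v : H) : norm v <= norm1 B v.
Proof.
  rewrite <- (sqrt_pow2 (norm v)) by apply norm_ge_0. apply sqrt_le_1_alt.
  pose proof (pow2_ge_0 (norm (B v))). lra.
Qed.

Lemma norm_op_le_norm1 (v : H) : norm (B v) <= norm1 B v.
Proof.
  rewrite <- (sqrt_pow2 (norm (B v))) by apply norm_ge_0. apply sqrt_le_1_alt.
  pose proof (pow2_ge_0 (norm v)). lra.
Qed.

Lemma norm1_le_sum (v : H) : norm1 B v <= norm v + norm (B v).
Proof.
  pose proof (norm_ge_0 v). pose proof (norm_ge_0 (B v)).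
  rewrite <- (sqrt_pow2 (norm v + norm (B v))) by lra. apply sqrt_le_1_alt. nra.
Qed.

Lemma norm_scal_eq (a : R) (v : H) : norm (scal a v) = Rabs a * norm v.
Proof.
  rewrite (norm_inner H v), (norm_inner H (scal a v)), <- sqrt_Rsqr_abs.
  rewrite <- sqrt_mult_alt by apply Rle_0_sqr.
  f_equal. expand_inner. unfold Rsqr. ring.
Qed.

Lemma norm1_scal (a : R) (v : H) : dom B v -> norm1 B (scal a v) = Rabs a * norm1 B v.
Proof.
  intros Dv. unfold norm1. rewrite op_scal by assumption. rewrite !norm_scal_eq.
  rewrite <- (sqrt_Rsqr_abs a) at 3. rewrite <- sqrt_mult_alt by apply Rle_0_sqr.
  f_equal. rewrite Rsqr_abs. unfold Rsqr. ring.
Qed.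

(** The crude factor 2 comes from bounding [norm1] by the sum of the two norms, each at most
    [norm1]; it only affects the radius on which [L] is bounded. *)
Lemma norm1_plus_le (v w : H) : dom B v -> dom B w ->
  norm1 B (plus v w) <= 2 * (norm1 B v + norm1 B w).
Proof.
  intros Dv Dw. eapply Rle_trans; [apply norm1_le_sum|]. rewrite op_plus by assumption.
  pose proof (norm_plus_le H v w). pose proof (norm_plus_le H (B v) (B w)).
  pose proof (norm_le_norm1 v). pose proof (norm_le_norm1 w).
  pose proof (norm_op_le_norm1 v). pose proof (norm_op_le_norm1 w). lra.
Qed.

Variables (F : H -> R) (G : H -> H) (L : R -> R -> R).
Hypothesis F_potential : is_potential B F G.
Hypothesis L_bounded : positive_locally_bounded L.
Hypothesis G_lipschitz : locally_lipschitz B G L.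

Lemma is_derive_line (v h : H) (a : R) : dom B v -> dom B h ->
  is_derive (fun r => F (plus v (scal r h))) a (inner H (G (plus v (scal a h))) h).
Proof.
  intros Dv Dh.
  split; [apply is_linear_scal_l|].
  intros x Hx [eps Heps]. rewrite <- (is_filter_lim_locally_unique _ _ Hx). clear x Hx.
  simpl. pose proof (norm1_ge_0 h) as Hh.
  destruct F_potential as [_ [_ HF]].
  (* Adding 1 to the norm of [h] keeps the quotient meaningful when [h] is zero. *)
  assert (He : 0 < eps / (norm1 B h + 1)) by (apply Rdiv_lt_0_compat; lra).
  destruct (HF (plus v (scal a h))) with (eps := eps / (norm1 B h + 1)) as [d [Hd HFd]];
    [apply dom_plus; [assumption|now apply dom_scal]|assumption|].
  assert (Hd' : 0 < d / (norm1 B h + 1)) by (apply Rdiv_lt_0_compat; lra).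
  exists (mkposreal _ Hd'). intros r Hr.
  change (Rabs (r - a) < d / (norm1 B h + 1)) in Hr.
  change (Rabs (F (plus v (scal r h)) - F (plus v (scal a h))
    - (r - a) * inner H (G (plus v (scal a h))) h) <= eps * Rabs (r - a)).
  specialize (HFd (scal (r - a) h)). rewrite norm1_scal in HFd by assumption.
  assert (E : plus (plus v (scal a h)) (scal (r - a) h) = plus v (scal r h)).
  { apply inner_ext. intros w. expand_inner. ring. }
  rewrite E, inner_scal_r in HFd.
  assert (Ha : 0 <= Rabs (r - a)) by apply Rabs_pos.
  eapply Rle_trans; [apply HFd; [now apply dom_scal|]|].
  - apply Rle_lt_trans with (Rabs (r - a) * (norm1 B h + 1)); [nra|].
    apply Rmult_lt_compat_r with (r := norm1 B h + 1) in Hr; [|lra].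
    replace (d / (norm1 B h + 1) * (norm1 B h + 1)) with d in Hr by (field; lra). lra.
  - apply Rle_trans with (eps / (norm1 B h + 1) * (Rabs (r - a) * (norm1 B h + 1))).
    + apply Rmult_le_compat_l; nra.
    + right. field. lra.
Qed.

(* Taylor bound with the weaker H norm in one of the factors, which is what makes
   F(u(t)) differentiable although u is only C^1 in H. *)
Lemma potential_increment (v : H) : dom B v -> exists M, 0 <= M /\
  forall h, dom B h -> norm1 B h <= 1 ->
    norm (minus (G (plus v h)) (G v)) <= M * norm1 B h /\
    Rabs (F (plus v h) - F v - inner H (G v) h) <= M * norm1 B h * norm h.
Proof.
  intros Dv.
  (* By [norm1_plus_le] this radius contains both [v] and every [plus v h] with [norm1 B h <= 1]. *)
  destruct L_bounded as [Lpos Lb]. destruct (Lb (2 * (norm1 B v + 1))) as [M HM].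
  pose proof (norm1_ge_0 v) as Hv.
  assert (HG : forall h, dom B h -> norm1 B h <= 1 ->
    norm (minus (G (plus v h)) (G v)) <= M * norm1 B h).
  { intros h Dh Hh. pose proof (norm1_ge_0 h).
    eapply Rle_trans; [apply G_lipschitz; [now apply dom_plus|assumption]|].
    replace (minus (plus v h) v) with h by
      (apply inner_ext; intros w; expand_inner; ring).
    apply Rmult_le_compat_r; [assumption|]. apply HM; split; try apply norm1_ge_0; try lra.
    eapply Rle_trans; [now apply norm1_plus_le|]. lra. }
  assert (HM0 : 0 <= M).
  { left. eapply Rlt_le_trans; [apply (Lpos 0 0); lra|apply HM; lra]. }
  exists M. split; [assumption|]. intros h Dh Hh. split; [now apply HG|].
  pose proof (norm1_ge_0 h). pose proof (norm_ge_0 h).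
  (* The mean value theorem on the segment turns the Taylor remainder into <G(v + c h) - G(v), h>:
     the Lipschitz bound uses [norm1 B h], while Cauchy-Schwarz leaves the plain norm of [h]. *)
  destruct (MVT_gen (fun r => F (plus v (scal r h))) 0 1
    (fun r => inner H (G (plus v (scal r h))) h)) as [c [Hc Ec]].
  - intros r _. now apply is_derive_line.
  - intros r _. apply continuity_pt_filterlim, (ex_derive_continuous (V := R_NormedModule)).
    eexists. now apply is_derive_line.
  - rewrite Rmin_left, Rmax_right in Hc by lra.
    assert (E1 : plus v (scal 1 h) = plus v h) by (apply inner_ext; intros w; expand_inner; ring).
    assert (E0 : plus v (scal 0 h) = v) by (apply inner_ext; intros w; expand_inner; ring).
    rewrite E1, E0 in Ec. rewrite Ec.
    replace (_ - _) with (inner H (minus (G (plus v (scal c h))) (G v)) h)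
      by (rewrite inner_minus; ring).
    eapply Rle_trans; [apply Cauchy_Schwarz|]. apply Rmult_le_compat_r; [assumption|].
    assert (Ec1 : norm1 B (scal c h) = c * norm1 B h)
      by (rewrite norm1_scal, Rabs_pos_eq; [reflexivity|lra|assumption]).
    eapply Rle_trans; [apply HG; [now apply dom_scal|rewrite Ec1; nra]|].
    rewrite Ec1. apply Rmult_le_compat_l; nra.
Qed.

Variables (u : R -> H) (t : R).
Hypothesis u_dom : forall r, dom B (u r).
Hypothesis u_continuous1 :
  filterlim (fun r => norm1 B (minus (u r) (u t))) (locally t) (locally 0).

Lemma continuous1_eps (eps : R) : 0 < eps ->
  locally t (fun r => norm1 B (minus (u r) (u t)) < eps).
Proof.
  intros Heps.
  generalize (proj1 (filterlim_locally _ 0) u_continuous1 (mkposreal eps Heps)).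
  apply filter_imp. intros r Hr.
  change (Rabs (norm1 B (minus (u r) (u t)) - 0) < eps) in Hr.
  rewrite Rminus_0_r in Hr. now apply Rabs_lt_between in Hr.
Qed.

Lemma continuous1_continuous : continuous u t.
Proof.
  apply (filterlim_norm_minus H (F := locally t)). intros eps Heps.
  generalize (continuous1_eps eps Heps). apply filter_imp. intros r.
  apply Rle_lt_trans, norm_le_norm1.
Qed.

Lemma continuous1_op : continuous (fun r => B (u r)) t.
Proof.
  apply (filterlim_norm_minus H (F := locally t)). intros eps Heps.
  generalize (continuous1_eps eps Heps). apply filter_imp. intros r.
  rewrite <- op_minus by auto. apply Rle_lt_trans, norm_op_le_norm1.
Qed.

Let plus_minus (x y : H) : plus x (minus y x) = y.
Proof. apply inner_ext. intros w. expand_inner. ring. Qed.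

Lemma continuous1_gradient : continuous (fun r => G (u r)) t.
Proof.
  apply (filterlim_norm_minus H (F := locally t)). intros eps Heps.
  destruct (potential_increment (u t) (u_dom t)) as [M [HM HG]].
  assert (He : 0 < eps / (M + 1)) by (apply Rdiv_lt_0_compat; lra).
  generalize (filter_and _ _ (continuous1_eps 1 Rlt_0_1) (continuous1_eps _ He)).
  apply filter_imp. intros r [H1 H2].
  destruct (HG (minus (u r) (u t))) as [HGr _]; [now apply dom_minus|lra|].
  rewrite plus_minus in HGr. eapply Rle_lt_trans; [exact HGr|].
  pose proof (norm1_ge_0 (minus (u r) (u t))).
  apply Rmult_lt_compat_l with (r := M + 1) in H2; [|lra].
  replace ((M + 1) * (eps / (M + 1))) with eps in H2 by (field; lra). nra.
Qed.

Lemma continuous1_potential : continuous (fun r => F (u r)) t.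
Proof.
  apply filterlim_locally. intros [eps Heps].
  destruct (potential_increment (u t) (u_dom t)) as [M [HM HG]].
  pose proof (norm_ge_0 (G (u t))) as HGt.
  set (N := M + norm (G (u t)) + 1).
  assert (He : 0 < eps / N) by (apply Rdiv_lt_0_compat; unfold N; lra).
  generalize (filter_and _ _ (continuous1_eps 1 Rlt_0_1) (continuous1_eps _ He)).
  apply filter_imp. intros r [H1 H2].
  change (Rabs (F (u r) - F (u t)) < eps).
  destruct (HG (minus (u r) (u t))) as [_ HFr]; [now apply dom_minus|lra|].
  rewrite plus_minus in HFr.
  set (h := minus (u r) (u t)) in *.
  pose proof (norm1_ge_0 h). pose proof (norm_ge_0 h). pose proof (norm_le_norm1 h).
  pose proof (Cauchy_Schwarz H (G (u t)) h).
  apply Rmult_lt_compat_l with (r := N) in H2; [|unfold N; lra].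
  replace (N * (eps / N)) with eps in H2 by (field; unfold N; lra).
  replace (F (u r) - F (u t)) with
    (F (u r) - F (u t) - inner H (G (u t)) h + inner H (G (u t)) h) by ring.
  eapply Rle_lt_trans; [apply Rabs_triang|].
  apply Rle_lt_trans with (N * norm1 B h); [|assumption].
  assert (M * norm1 B h * norm h <= M * norm1 B h) by (rewrite <- Rmult_1_r; apply Rmult_le_compat_l; nra).
  unfold N. nra.
Qed.

(** With h the increment of [u], the Taylor error is at most M [norm1 B h] |h|. Differentiability in
    H makes |h| of order |r - t|, and mere continuity in H_1 makes the other factor tend to 0, so
    the product is o(|r - t|). *)
Lemma is_derive_potential (du : H) : is_derive u t du ->
  is_derive (fun r => F (u r)) t (inner H (G (u t)) du).
Proof.
  intros Hu.
  split; [apply is_linear_scal_l|].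
  intros x Hx [eps Heps]. rewrite <- (is_filter_lim_locally_unique _ _ Hx). clear x Hx.
  simpl.
  destruct (potential_increment (u t) (u_dom t)) as [M [HM HG]].
  pose proof (norm_ge_0 (G (u t))) as HGt. pose proof (norm_ge_0 du) as Hdu.
  set (N := M * (norm du + 1) + norm (G (u t)) + 1).
  assert (HN : 0 < N) by (unfold N; nra).
  set (d := Rmin 1 (eps / N)).
  assert (Hd : 0 < d).
  { apply Rmin_glb_lt; [lra|]. now apply Rdiv_lt_0_compat. }
  assert (Hd1 : d <= 1) by apply Rmin_l.
  assert (Hde : d * N <= eps).
  { apply Rle_trans with (eps / N * N).
    - apply Rmult_le_compat_r; [lra|apply Rmin_r].
    - right. field. lra. }
  generalize (filter_and _ _ (continuous1_eps d Hd)
    (proj1 (is_derive_norm_minus H u t du) Hu d Hd)).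
  apply filter_imp. intros r [H1 H2].
  change (Rabs (F (u r) - F (u t) - (r - t) * inner H (G (u t)) du) <= eps * Rabs (r - t)).
  destruct (HG (minus (u r) (u t))) as [_ HFr]; [now apply dom_minus|lra|].
  rewrite plus_minus in HFr.
  set (h := minus (u r) (u t)) in *. set (q := minus h (scal (r - t) du)) in *.
  pose proof (Rabs_pos (r - t)) as Ha.
  pose proof (norm1_ge_0 h). pose proof (norm_ge_0 h). pose proof (norm_ge_0 q).
  pose proof (Cauchy_Schwarz H (G (u t)) q).
  assert (Hh : norm h <= (norm du + 1) * Rabs (r - t)).
  { replace h with (plus q (scal (r - t) du)) by
      (unfold q; apply inner_ext; intros w; expand_inner; ring).
    eapply Rle_trans; [apply norm_plus_le|]. rewrite norm_scal_eq. nra. }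
  set (a := Rabs (r - t)) in *.
  replace (F (u r) - F (u t) - (r - t) * inner H (G (u t)) du) with
    ((F (u r) - F (u t) - inner H (G (u t)) h) + inner H (G (u t)) q)
    by (unfold q; expand_inner; ring).
  eapply Rle_trans; [apply Rabs_triang|].
  assert (M * norm1 B h * norm h <= M * d * ((norm du + 1) * a)).
  { apply Rmult_le_compat; nra. }
  assert (norm (G (u t)) * norm q <= norm (G (u t)) * (d * a)) by nra.
  apply Rle_trans with (d * N * a); [|now apply Rmult_le_compat_r].
  assert (0 <= d * a) by nra. unfold N. nra.
Qed.

End Potential.

(** * The Lyapunov functional *)

(** Differentiability is asked only in the open interval because the energy identity is available
    only for times after [t0]; at [t0] itself the energy is merely continuous. *)
Lemma nonincreasing_of_derive (f df : R -> R) (a b : R) : a <= b ->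
  (forall t, a < t < b -> is_derive f t (df t)) ->
  (forall t, a <= t <= b -> continuous f t) ->
  (forall t, a <= t <= b -> df t <= 0) -> f b <= f a.
Proof.
  intros Hab Df Cf Hdf.
  destruct (MVT_gen f a b df) as [c [Hc Ec]];
    rewrite Rmin_left, Rmax_right in * by lra.
  - exact Df.
  - intros t Ht. now apply continuity_pt_filterlim, Cf.
  - specialize (Hdf c Hc). nra.
Qed.

Section Lyapunov.

(** The argument is scalar from here on: a = |u'|^2, b = |A^{1/2}u|^2, X = <u', u>, N = |u|^2, P =
    F(u) and g = <grad F(u), u>. [X_bound] is Cauchy-Schwarz, [N_bound] coercivity, and [g_bound]
    the superquadratic condition. *)
Variables (a b X N P g : R -> R) (alpha nu t0 : R).
Hypothesis alpha_pos : 0 < alpha.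
Hypothesis nu_pos : 0 < nu.
Hypothesis t0_pos : 0 < t0.
Hypothesis a_nonneg : forall t, 0 <= a t.
Hypothesis b_nonneg : forall t, 0 <= b t.
Hypothesis N_nonneg : forall t, 0 <= N t.
Hypothesis P_nonneg : forall t, 0 <= P t.
Hypothesis X_bound : forall t, X t ^ 2 <= a t * N t.
Hypothesis N_bound : forall t, nu * N t <= b t.
Hypothesis g_bound : forall t, 2 * P t <= g t.

Let E (t : R) : R := / 2 * a t + / 2 * b t + P t.

Hypothesis E_continuous : forall t, continuous E t.
Hypothesis E_derive : forall t, t0 < t -> is_derive E t (- (alpha / t) * a t).
Hypothesis X_derive : forall t, t0 < t ->
  is_derive X t (a t - b t - alpha / t * X t - g t).
Hypothesis N_derive : forall t, t0 < t -> is_derive N t (2 * X t).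

Let lambda := alpha / 2.

Let Z (t : R) : R := E t + lambda / t * X t + lambda / (2 * t ^ 2) * N t.

Variable T : R.
Hypothesis T_gt : t0 < T.
Hypothesis T_large1 : 3 * lambda ^ 2 <= nu * T ^ 2.
Hypothesis T_large2 : 3 * lambda <= nu * T ^ 2.
Hypothesis T_large3 : 10 * lambda * Rabs (lambda - 1) <= nu * T ^ 2.

Let lambda_pos : 0 < lambda.
Proof. unfold lambda. lra. Qed.

Let E_nonneg t : 0 <= E t.
Proof. specialize (a_nonneg t). specialize (b_nonneg t). specialize (P_nonneg t). unfold E. lra. Qed.

Lemma energy_nonincreasing : E T <= E t0.
Proof.
  apply (nonincreasing_of_derive E (fun t => - (alpha / t) * a t)); [lra| | |].
  - intros t Ht. apply E_derive. lra.
  - intros t _. apply E_continuous.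
  - intros t Ht. assert (0 < alpha / t) by (apply Rdiv_lt_0_compat; lra).
    specialize (a_nonneg t). nra.
Qed.

(** The cross term p satisfies |p| <= sqrt(ab/3) <= 3/10 (a + b), as 1/(2 sqrt 3) < 3/10, and the
    last term satisfies 0 <= q <= b/6. Hence 1/2 - 3/10 = 1/5 gives the lower factor 2/5, and 1/2 +
    3/10 together with b/6 gives 8/5 + 1/3. *)
Lemma functional_bounds t : T <= t -> 2 / 5 * E t <= Z t <= (8 / 5 + 1 / 3) * E t.
Proof.
  intros Ht. assert (HT : 0 < T) by lra. assert (Ht0 : 0 < t) by lra.
  assert (Htt : 0 < t ^ 2) by (apply pow_lt; lra).
  assert (HTt : nu * T ^ 2 <= nu * t ^ 2) by (apply Rmult_le_compat_l; [lra|apply pow_incr; lra]).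
  specialize (a_nonneg t). specialize (b_nonneg t). specialize (N_nonneg t).
  specialize (P_nonneg t). specialize (X_bound t). specialize (N_bound t).
  set (p := lambda / t * X t). set (q := lambda / (2 * t ^ 2) * N t).
  assert (Hp : p ^ 2 <= a t * b t / 3).
  { assert (Ep : nu * t ^ 2 * p ^ 2 = nu * lambda ^ 2 * X t ^ 2)
      by (unfold p; field; lra).
    assert (H1 : nu * lambda ^ 2 * X t ^ 2 <= lambda ^ 2 * (a t * b t)).
    { apply Rle_trans with (lambda ^ 2 * (a t * (nu * N t))).
      - replace (lambda ^ 2 * (a t * (nu * N t))) with (nu * lambda ^ 2 * (a t * N t)) by ring.
        apply Rmult_le_compat_l; [|assumption]. apply Rmult_le_pos; [lra|apply pow2_ge_0].
      - apply Rmult_le_compat_l; [apply pow2_ge_0|]. now apply Rmult_le_compat_l. }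
    assert (H2 : lambda ^ 2 * (a t * b t) <= nu * t ^ 2 * (a t * b t / 3)).
    { replace (nu * t ^ 2 * (a t * b t / 3)) with (nu * t ^ 2 / 3 * (a t * b t)) by field.
      apply Rmult_le_compat_r; [now apply Rmult_le_pos|lra]. }
    apply Rmult_le_reg_l with (nu * t ^ 2); [now apply Rmult_lt_0_compat|lra]. }
  assert (Hp' : Rabs p <= 3 / 10 * (a t + b t)).
  { rewrite <- (Rabs_pos_eq (3 / 10 * (a t + b t))) by lra.
    apply Rsqr_le_abs_0. unfold Rsqr.
    pose proof (pow2_ge_0 (a t - b t)). pose proof (Rmult_le_pos _ _ a_nonneg b_nonneg). nra. }
  apply Rabs_le_between in Hp'.
  assert (Hq0 : 0 <= q).
  { unfold q. apply Rmult_le_pos; [|assumption]. apply Rlt_le, Rdiv_lt_0_compat; lra. }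
  assert (Hq : q <= b t / 6).
  { assert (Eq : nu * t ^ 2 * q = lambda / 2 * (nu * N t)) by (unfold q; field; lra).
    assert (lambda / 2 * (nu * N t) <= lambda / 2 * b t) by (apply Rmult_le_compat_l; lra).
    apply Rmult_le_reg_l with (nu * t ^ 2); [now apply Rmult_lt_0_compat|]. nra. }
  unfold Z. fold p q. unfold E. lra.
Qed.

(** Since Z >= 2/5 E >= b/5 >= nu N/5, this is the value for which K Z dominates lambda |lambda - 1|
    N. *)
Let K := 5 * lambda * Rabs (lambda - 1) / nu.
Let weight (t : R) : R := exp (alpha * ln t + K / (2 * t ^ 2)).

Let K_nonneg : 0 <= K.
Proof.
  unfold K. apply Rmult_le_pos; [|left; now apply Rinv_0_lt_compat].
  apply Rmult_le_pos; [lra|apply Rabs_pos].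
Qed.

(** After the cancellations at orders 1/t and 1/t^2 only N/t^3 and the nonlinear terms survive. The
    factor [exp (K / (2 * t ^ 2))] has logarithmic derivative -K/t^3, hence the term - K Z beside
    N. *)
Lemma is_derive_functional t : t0 < t ->
  is_derive (fun r => weight r * Z r) t
    (weight t * (lambda / t * (2 * P t - g t)
      + (lambda * (lambda - 1) * N t - K * Z t) / t ^ 3)).
Proof.
  intros Ht.
  assert (Dw : is_derive weight t (weight t * (alpha / t - K / t ^ 3))).
  { rewrite Rmult_comm.
    apply (is_derive_comp exp (fun r => alpha * ln r + K / (2 * r ^ 2))).
    - apply is_derive_exp.
    - auto_derive; [repeat split; nra|]. field. lra. }
  assert (D1 : is_derive (fun r => lambda / r) t (- lambda / t ^ 2)).
  { auto_derive; [lra|]. field. lra. }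
  assert (D2 : is_derive (fun r => lambda / (2 * r ^ 2)) t (- lambda / t ^ 3)).
  { auto_derive; [nra|]. field. lra. }
  assert (DZ : is_derive Z t (- (alpha / t) * a t
    + (- lambda / t ^ 2 * X t + lambda / t * (a t - b t - alpha / t * X t - g t))
    + (- lambda / t ^ 3 * N t + lambda / (2 * t ^ 2) * (2 * X t)))).
  { apply (is_derive_plus (V := R_NormedModule)); [apply (is_derive_plus (V := R_NormedModule))|].
    - now apply E_derive.
    - apply (is_derive_mult (fun r => lambda / r) X); [assumption|now apply X_derive|].
      exact Rmult_comm.
    - apply (is_derive_mult (fun r => lambda / (2 * r ^ 2)) N); [assumption|now apply N_derive|].
      exact Rmult_comm. }
  pose proof (is_derive_mult weight Z t _ _ Dw DZ Rmult_comm) as D.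
  match type of D with is_derive _ _ ?l => match goal with |- is_derive _ _ ?l' =>
    replace l' with l; [exact D|] end end.
  unfold plus, mult; simpl. unfold Z, E, lambda. field. lra.
Qed.

Lemma functional_nonincreasing t : T <= t -> weight t * Z t <= weight T * Z T.
Proof.
  intros Ht.
  apply (nonincreasing_of_derive (fun r => weight r * Z r) (fun r =>
    weight r * (lambda / r * (2 * P r - g r)
      + (lambda * (lambda - 1) * N r - K * Z r) / r ^ 3))); [assumption| | |].
  - intros r Hr. apply is_derive_functional. lra.
  - intros r Hr. apply (ex_derive_continuous (V := R_NormedModule)).
    eexists. apply is_derive_functional. lra.
  - intros r [Hr _]. assert (Hr0 : 0 < r) by lra.
    assert (H1 : lambda / r * (2 * P r - g r) <= 0).
    { assert (0 < lambda / r) by now apply Rdiv_lt_0_compat.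
      specialize (g_bound r). nra. }
    assert (H2 : lambda * (lambda - 1) * N r - K * Z r <= 0).
    { destruct (functional_bounds r Hr) as [HZ _].
      specialize (a_nonneg r). specialize (P_nonneg r).
      specialize (N_bound r). specialize (N_nonneg r).
      assert (HZb : b r / 5 <= Z r) by (revert HZ; unfold E; lra).
      assert (HK : nu * K = 5 * lambda * Rabs (lambda - 1)) by (unfold K; field; lra).
      assert (HKZ : K * (nu * N r / 5) <= K * Z r) by (apply Rmult_le_compat_l; lra).
      replace (K * (nu * N r / 5)) with (nu * K * (N r / 5)) in HKZ by field.
      rewrite HK in HKZ.
      pose proof (Rle_abs (lambda - 1)).
      assert (lambda * (lambda - 1) * N r <= lambda * Rabs (lambda - 1) * N r).
      { apply Rmult_le_compat_r; [assumption|]. apply Rmult_le_compat_l; lra. }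
      lra. }
    assert (H3 : (lambda * (lambda - 1) * N r - K * Z r) / r ^ 3 <= 0).
    { assert (0 < / r ^ 3) by (apply Rinv_0_lt_compat, pow_lt; lra).
      unfold Rdiv. nra. }
    assert (0 < weight r) by apply exp_pos. nra.
Qed.

Lemma energy_decay t : T <= t -> E t <= 8 * Rpower T alpha * E t0 * Rpower t (- alpha).
Proof.
  intros Ht. assert (HT : 0 < T) by lra.
  assert (HTT : 0 < T ^ 2) by (apply pow_lt; lra).
  pose proof (functional_nonincreasing t Ht) as HM.
  destruct (functional_bounds t Ht) as [HZ _].
  destruct (functional_bounds T (Rle_refl T)) as [_ HZT].
  pose proof energy_nonincreasing as HE.
  assert (HwT : weight T <= 4 / 3 * Rpower T alpha).
  { unfold weight. rewrite exp_plus, Rmult_comm.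
    apply Rmult_le_compat_r; [left; apply exp_pos|].
    (* [T_large3] carries the factor 10 so that this exponent is at most 1/4; then exp(-x) >= 1 - x
       >= 3/4 bounds the weight's exponential by 4/3. *)
    assert (HK : K / (2 * T ^ 2) <= 1 / 4).
    { apply Rmult_le_reg_r with (4 * (nu * T ^ 2)); [nra|].
      replace (K / (2 * T ^ 2) * (4 * (nu * T ^ 2)))
        with (10 * lambda * Rabs (lambda - 1)) by (unfold K; field; lra). lra. }
    assert (H1 : 3 / 4 <= exp (- (K / (2 * T ^ 2)))).
    { pose proof (exp_ineq1_le (- (K / (2 * T ^ 2)))). lra. }
    rewrite exp_Ropp in H1. pose proof (exp_pos (K / (2 * T ^ 2))) as H2.
    apply Rmult_le_compat_l with (r := exp (K / (2 * T ^ 2))) in H1; [|lra].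
    rewrite Rinv_r in H1 by lra. lra. }
  assert (Hwt : Rpower t alpha <= weight t).
  { unfold weight. rewrite exp_plus. fold (Rpower t alpha).
    assert (1 <= exp (K / (2 * t ^ 2))).
    { assert (0 <= K / (2 * t ^ 2)).
      { apply Rmult_le_pos; [assumption|]. left. apply Rinv_0_lt_compat. nra. }
      pose proof (exp_ineq1_le (K / (2 * t ^ 2))). lra. }
    pose proof (exp_pos (alpha * ln t)) as H0. fold (Rpower t alpha) in H0. nra. }
  assert (Hpt : 0 < Rpower t alpha) by apply exp_pos.
  assert (HpT : 0 < Rpower T alpha) by apply exp_pos.
  pose proof (E_nonneg t). pose proof (E_nonneg T). pose proof (E_nonneg t0).
  assert (Hmain : Rpower t alpha * E t <= 8 * Rpower T alpha * E t0).
  { assert (Rpower t alpha * (2 / 5 * E t) <= weight t * Z t).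
    { apply Rmult_le_compat; lra. }
    assert (weight T * Z T <= 4 / 3 * Rpower T alpha * ((8 / 5 + 1 / 3) * E t0)).
    { assert (0 < weight T) by apply exp_pos.
      apply Rle_trans with (weight T * ((8 / 5 + 1 / 3) * E t0)).
      - apply Rmult_le_compat_l; lra.
      - apply Rmult_le_compat_r; lra. }
    assert (0 <= Rpower T alpha * E t0) by (apply Rmult_le_pos; lra). lra. }
  rewrite Rpower_Ropp. apply Rmult_le_reg_l with (Rpower t alpha); [assumption|].
  replace (Rpower t alpha * (8 * Rpower T alpha * E t0 * / Rpower t alpha))
    with (8 * Rpower T alpha * E t0) by (field; lra). assumption.
Qed.

End Lyapunov.

(* If alpha <> 2 the bound on t3 is of order 1 / eps; if alpha = 2 the third
   inequality is void and the bound on t1 suffices. *)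
Lemma threshold_large (alpha nu : R) : 0 < alpha -> 0 < nu ->
  exists eps0 : R, 0 < eps0 /\
  forall eps : R, 0 < eps < eps0 -> forall t1 t3 : R, 0 < t1 -> 0 < t3 ->
  2 * (alpha / 2) / nu * Rabs (alpha - 1) <= t1 ^ 2 ->
  (alpha / 2 + eps) * (1 + 2 * eps) / (2 * nu * eps)
    * Rabs (alpha - 2 - 2 * eps) + t1 ^ 2 <= t3 ^ 2 ->
  t1 < t3 /\ 3 * (alpha / 2) ^ 2 <= nu * t3 ^ 2 /\ 3 * (alpha / 2) <= nu * t3 ^ 2 /\
  10 * (alpha / 2) * Rabs (alpha / 2 - 1) <= nu * t3 ^ 2.
Proof.
  intros Halpha Hnu.
  assert (Hlt : forall x y, 0 < x -> 0 < y -> x ^ 2 < y ^ 2 -> x < y) by (intros; nra).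
  destruct (Req_dec alpha 2) as [->|Hne].
  (* For alpha = 2 the absolute value equals 2 eps and cancels the eps in the denominator. Then nu
     t3^2 >= 1 + nu t1^2 >= 3, exactly what the first two inequalities require. *)
  - exists 1. split; [lra|]. intros eps Heps t1 t3 Ht1 Ht3 H1 H3.
    replace (2 - 1) with 1 in H1 by ring.
    replace (2 - 2 - 2 * eps) with (- (2 * eps)) in H3 by ring.
    rewrite Rabs_Ropp, Rabs_pos_eq in H3 by lra. rewrite Rabs_R1 in H1.
    replace ((2 / 2 + eps) * (1 + 2 * eps) / (2 * nu * eps) * (2 * eps))
      with ((1 + eps) * (1 + 2 * eps) / nu) in H3 by (field; lra).
    apply Rmult_le_compat_l with (r := nu) in H1; [|lra].
    assert (Hpos : 0 < (1 + eps) * (1 + 2 * eps) / nu) by (apply Rdiv_lt_0_compat; nra).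
    assert (t1 < t3) by (apply Hlt; lra).
    apply Rmult_le_compat_l with (r := nu) in H3; [|lra].
    replace (nu * (2 * (2 / 2) / nu * 1)) with 2 in H1 by (field; lra).
    replace (nu * ((1 + eps) * (1 + 2 * eps) / nu + t1 ^ 2))
      with ((1 + eps) * (1 + 2 * eps) + nu * t1 ^ 2) in H3 by (field; lra).
    replace (2 / 2) with 1 by field. rewrite Rminus_diag, Rabs_R0.
    repeat split; nra.
  - set (m := Rabs (alpha - 2)). assert (Hm : 0 < m) by (apply Rabs_pos_lt; lra).
    set (l := alpha / 2). assert (Hl : 0 < l) by (unfold l; lra).
    set (C := 3 * l ^ 2 + 3 * l + 10 * l * Rabs (l - 1)).
    assert (Hl1 : 0 <= l * Rabs (l - 1)) by (apply Rmult_le_pos; [lra|apply Rabs_pos]).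
    assert (HC : 0 < C) by (unfold C; nra).
    (* The bound m/4 keeps |alpha - 2 - 2 eps| above m/2; the second bound makes l m / (4 eps) at
       least [C], whose summands are the three required lower bounds. *)
    exists (Rmin (m / 4) (l * m / (4 * C))).
    assert (HlmC : 0 < l * m / (4 * C)) by (apply Rdiv_lt_0_compat; nra).
    split; [apply Rmin_glb_lt; lra|].
    intros eps [Heps Hup] t1 t3 Ht1 Ht3 _ H3.
    pose proof (Rmin_l (m / 4) (l * m / (4 * C))).
    pose proof (Rmin_r (m / 4) (l * m / (4 * C))).
    assert (He : 4 * C * eps <= l * m).
    { apply Rle_trans with (4 * C * (l * m / (4 * C))).
      - apply Rmult_le_compat_l; lra.
      - right. field. lra. }
    assert (Hab : m / 2 <= Rabs (alpha - 2 - 2 * eps)).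
    { pose proof (Rabs_triang_inv (alpha - 2) (2 * eps)) as Ht. fold m in Ht.
      rewrite (Rabs_pos_eq (2 * eps)) in Ht by lra. lra. }
    set (k := (l + eps) * (1 + 2 * eps) / (2 * nu * eps) * Rabs (alpha - 2 - 2 * eps)) in *.
    assert (Hk : C <= nu * k).
    { assert (Ek : 2 * eps * (nu * k) = (l + eps) * (1 + 2 * eps) * Rabs (alpha - 2 - 2 * eps))
        by (unfold k; field; lra).
      assert (l * (m / 2) <= (l + eps) * (1 + 2 * eps) * Rabs (alpha - 2 - 2 * eps)).
      { apply Rmult_le_compat; nra. }
      apply Rmult_le_reg_l with (2 * eps); lra. }
    assert (Hk0 : 0 < k).
    { apply Rmult_lt_reg_l with nu; [assumption|]. lra. }
    assert (Hkt : nu * k <= nu * t3 ^ 2).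
    { apply Rmult_le_compat_l; [lra|]. pose proof (pow2_ge_0 t1). lra. }
    split; [apply Hlt; lra|]. pose proof (pow2_ge_0 l). unfold C in Hk.
    repeat split; lra.
Qed.

(** * From the mild solution to the scalar argument *)

(** [Rmax t0] is 1-Lipschitz with values in the half-line, so composing with it turns continuity
    relative to the half-line into ordinary continuity. *)
Lemma Rmax_within (t0 t : R) :
  filterlim (Rmax t0) (locally t) (within (fun r => t0 <= r) (locally (Rmax t0 t))).
Proof.
  intros P [d Hd]. exists d. intros r Hr. apply Hd; [|apply Rmax_l].
  change (Rabs (Rmax t0 r - Rmax t0 t) < d). change (Rabs (r - t) < d) in Hr.
  eapply Rle_lt_trans; [|exact Hr].
  unfold Rmax, Rabs.
  destruct (Rle_dec t0 r), (Rle_dec t0 t); repeat destruct Rcase_abs; lra.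
Qed.

Lemma is_derive_of_on (H : HilbertSpace) (u : R -> H) (t0 t : R) (l : H) :
  t0 < t -> is_derive_on H (fun r => t0 <= r) u t l -> is_derive u t l.
Proof.
  intros Ht [_ Hu]. apply is_derive_norm_minus. intros eps Heps.
  assert (Hlim : is_filter_lim (within (fun r => t0 <= r) (locally t)) t).
  { intros Q HQ. unfold within. generalize HQ. apply filter_imp. auto. }
  pose proof (Hu t Hlim (mkposreal eps Heps)) as Hd. unfold within in Hd.
  generalize (filter_and _ _ Hd (locally_gt t0 t Ht)).
  apply filter_imp. intros r [Hr Htr]. apply Hr. lra.
Qed.

Theorem theorem3p4
  (H : HilbertSpace) (A B : operator H)
  (A_self_adjoint : self_adjoint A)
  (A_nonnegative : nonnegative_operator A)
  (B_sqrt : is_square_root A B)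
  (F : H -> R) (G : H -> H) (L0 : R -> R -> R) (s : R)
  (F_potential : is_potential B F G)
  (L0_bounded : positive_locally_bounded L0)
  (G_lipschitz : locally_lipschitz B G L0)
  (s_gt2 : 2 < s)
  (F_superquadratic : superquadratic B F G s)
  (S dS : R -> H -> H)
  (S_solution : is_solution_operator A B S dS)
  (nu : R) (nu_pos : 0 < nu) (A_coercive : coercive B nu)
  (alpha : R) (alpha_pos : 0 < alpha)
  (t0 : R) (t0_pos : 0 < t0) :
  exists eps0 : R, 0 < eps0 /\
  forall eps : R, 0 < eps < eps0 ->
  forall t1 : R, t0 <= t1 ->
  (forall lambda : R, lambda = alpha / 2 \/ lambda = alpha / 2 + eps ->
     Rmax (2 * lambda / nu * Rabs (alpha - 1))
          (lambda / nu * Rabs (3 * lambda + 1 - alpha)) <= t1 ^ 2) ->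
  forall t3 : R, 0 < t3 ->
  (alpha / 2 + eps) * (1 + 2 * eps) / (2 * nu * eps)
    * Rabs (alpha - 2 - 2 * eps) + t1 ^ 2 <= t3 ^ 2 ->
  2 * alpha * Rabs (alpha - 2) / nu + sqrt ((alpha + 2) / (3 * nu)) <= t3 ->
  forall u0 u1 : H, dom B u0 ->
  forall u du : R -> H,
  is_mild_solution B S dS (fun t : R => alpha / t) G t0 u0 u1 u du ->
  forall t : R, t3 <= t ->
    energy B F u du t
      <= 8 * Rpower t3 alpha * energy B F u du t0 * Rpower t (- alpha).
Proof.
  destruct (threshold_large alpha nu alpha_pos nu_pos) as [eps0 [Heps0 Hlarge]].
  exists eps0. split; [assumption|].
  intros eps Heps t1 Ht01 Ht1 t3 Ht3 Ht3' _ u0 u1 Du0 u du Hmild t Ht.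
  destruct (Hlarge eps Heps t1 t3) as [Ht13 [Hl1 [Hl2 Hl3]]]; [lra|assumption| |assumption|].
  (* The first entry of the maximum, for lambda = alpha/2. *)
  { eapply Rle_trans; [apply Rmax_l|]. now apply (Ht1 (alpha / 2)); left. }
  destruct Hmild as [[uD uC] [uDer [duC uMild]]].
  (* Constant extension to t < t0 replaces one-sided limits at t0 by two-sided ones. *)
  set (v := fun r => u (Rmax t0 r)). set (dv := fun r => du (Rmax t0 r)).
  set (f := fun r => plus (scal (alpha / Rmax t0 r) (dv r)) (G (v r))).
  assert (ext : forall r, t0 <= r -> Rmax t0 r = r) by (intros; now apply Rmax_right).
  assert (Rmax_pos : forall r, 0 < Rmax t0 r).
  { intros r. pose proof (Rmax_l t0 r). lra. }
  assert (vD : forall r, dom B (v r)) by (intros r; apply uD, Rmax_l).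
  assert (vC : forall r, filterlim (fun r' => norm1 B (minus (v r') (v r)))
    (locally r) (locally 0)).
  { intros r. exact (filterlim_comp _ _ _ (Rmax t0) _ _ _ _ (Rmax_within t0 r)
      (uC (Rmax t0 r) (Rmax_l t0 r))). }
  assert (dvC : forall r, continuous dv r).
  { intros r. exact (filterlim_comp _ _ _ (Rmax t0) _ _ _ _ (Rmax_within t0 r)
      (duC (Rmax t0 r) (Rmax_l t0 r))). }
  assert (vc : forall r, continuous v r) by (intros r; now apply continuous1_continuous with B).
  assert (Bvc : forall r, continuous (fun r' => B (v r')) r)
    by (intros r; now apply continuous1_op).
  assert (Gvc : forall r, continuous (fun r' => G (v r')) r)
    by (intros r; now apply continuous1_gradient with B F L0).
  assert (fc : forall r, continuous f r).
  { intros r. apply (continuous_plus (V := H)); [|apply Gvc].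
    apply (continuous_scal (V := H)); [|apply dvC].
    assert (Cmax : continuous (Rmax t0) r).
    { eapply filterlim_filter_le_2; [|apply Rmax_within].
      intros Q HQ. unfold within. generalize HQ. apply filter_imp. auto. }
    apply (continuous_comp (Rmax t0) (fun x => alpha / x)); [assumption|].
    apply (ex_derive_continuous (V := R_NormedModule)). specialize (Rmax_pos r).
    auto_derive. lra. }
  assert (vd : forall r, t0 < r -> is_derive v r (dv r)).
  { intros r Hr. unfold dv. rewrite ext by lra.
    apply (is_derive_ext_loc u).
    - generalize (locally_gt t0 r Hr). apply filter_imp. intros r' Hr'.
      unfold v. now rewrite ext by lra.
    - apply (is_derive_of_on H u t0); [assumption|]. apply uDer. lra. }
  assert (vm : forall r, t0 <= r -> exists I : H,
    is_RInt (fun tau => S (r - tau) (f tau)) t0 r I /\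
    v r = minus (plus (dS (r - t0) u0) (S (r - t0) u1)) I).
  { intros r Hr. destruct (uMild r Hr) as [I [HI Eu]]. exists I. split.
    - revert HI. apply is_RInt_ext. intros tau Htau.
      rewrite Rmin_left in Htau by assumption.
      unfold f, dv, v. now rewrite !ext by lra.
    - unfold v. now rewrite ext. }
  pose proof (mild_primitive H A B A_self_adjoint B_sqrt S dS S_solution t0 u0 u1 v dv f
    vc fc vd vm) as Heq.
  pose proof (is_derive_kinetic_potential H A B A_self_adjoint B_sqrt t0 u1 v dv f
    vD vc Bvc dvC fc vd Heq) as DE.
  pose proof (is_derive_cross H A B B_sqrt t0 u1 v dv f
    vD vc Bvc dvC fc vd Heq) as DX.
  assert (DF : forall r, t0 < r ->
    is_derive (fun r => F (v r)) r (inner H (G (v r)) (dv r))).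
  { intros r Hr. apply (is_derive_potential H B F G L0); auto. }
  assert (Een : forall r, t0 <= r -> energy B F u du r = / 2 * inner H (dv r) (dv r)
    + / 2 * inner H (B (v r)) (B (v r)) + F (v r)).
  { intros r Hr. unfold energy, dv, v. rewrite ext by assumption. now rewrite !inner_norm. }
  rewrite !Een by lra.
  pose proof (proj1 F_potential) as F_nonneg.
  apply (energy_decay (fun r => inner H (dv r) (dv r)) (fun r => inner H (B (v r)) (B (v r)))
    (fun r => inner H (dv r) (v r)) (fun r => inner H (v r) (v r)) (fun r => F (v r))
    (fun r => inner H (G (v r)) (v r)) alpha nu t0); auto; try lra.
  all: try (intros r; apply inner_self_nonneg).
  - intros r. rewrite !inner_norm, <- Rpow_mult_distr, <- pow2_abs.
    apply pow_incr. split; [apply Rabs_pos|apply Cauchy_Schwarz].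
  - intros r. rewrite !inner_norm. apply A_coercive, vD.
  (* Nonnegativity of F allows s > 2 to be lowered to 2 in the superquadratic inequality. *)
  - intros r. specialize (F_nonneg _ (vD r)). specialize (F_superquadratic _ (vD r)). nra.
  - intros r. apply (continuous_plus (V := R_NormedModule));
      [apply (continuous_plus (V := R_NormedModule))|].
    + apply (continuous_scal_r (V := R_NormedModule)), continuous_inner; apply dvC.
    + apply (continuous_scal_r (V := R_NormedModule)), continuous_inner; apply Bvc.
    + now apply continuous1_potential with B G L0.
  - intros r Hr.
    (* [f] is friction plus gradient; the gradient part cancels the derivative of F(u), and the
       friction loss alone remains. *)
    replace (- (alpha / r) * inner H (dv r) (dv r)) with
      (- inner H (f r) (dv r) + inner H (G (v r)) (dv r)).
    + apply (is_derive_plus (V := R_NormedModule)); [now apply DE|now apply DF].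
    + unfold f. rewrite ext by lra. expand_inner. ring.
  - intros r Hr.
    match goal with |- is_derive _ _ ?l => replace l with
      (inner H (dv r) (dv r) - inner H (B (v r)) (B (v r)) - inner H (f r) (v r)) end.
    + now apply DX.
    + unfold f. rewrite ext by lra. expand_inner. ring.
  - intros r Hr. replace (2 * inner H (dv r) (v r)) with
      (inner H (dv r) (v r) + inner H (v r) (dv r)) by (rewrite (inner_sym _ (v r)); ring).
    apply is_derive_inner; now apply vd.
Qed.
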